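(* For every $p\in(1,\infty]$ there exists a constant $C_p>0$ such that for every $d\in\mathbb N$ and every $f\in\ell^p(\mathbb Z^d)$ $$\Big\|\sup_{n\in\mathbb N_0}|\mathcal M_{2^n}^Qf|\Big\|_{\ell^p(\mathbb Z^d)}\le C_p\|f\|_{\ell^p(\mathbb Z^d)}.$$
   Context: $\mathbb N_0=\{0,1,2,\ldots\}$. For $t>0$ let $Q_t=[-t,t]^d$ and $Q=Q_1=[-1,1]^d$. For $f:\mathbb Z^d\to\mathbb C$ and $x\in\mathbb Z^d$, $$\mathcal M_t^Qf(x)=\frac{1}{|Q_t\cap\mathbb Z^d|}\sum_{y\in Q_t\cap\mathbb Z^d}f(x-y),$$ where $|Q_t\cap\mathbb Z^d|=(2\lfloor t\rfloor+1)^d$ is the number of lattice points in $Q_t$. *)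

(* Defs.v *)
From HB Require Import structures.
From mathcomp Require Import all_boot all_order all_algebra.
From mathcomp Require Import complex.
From mathcomp Require Import finmap.
From mathcomp Require Import all_classical all_reals all_analysis.
Set Implicit Arguments.
Unset Strict Implicit.
Unset Printing Implicit Defensive.
Import Order.TTheory GRing.Theory Num.Theory.
Import numFieldNormedType.Exports.
Local Open Scope classical_set_scope.
Local Open Scope ring_scope.

(* An alias of 'rV[int]_d, so that it can carry the discrete sigma-algebra
   (every set, hence every function, is measurable) without interfering with
   other structures on matrices. *)
Definition Zd (d : nat) : Type := 'rV[int]_d.

HB.instance Definition _ (d : nat) := GRing.Zmodule.on (Zd d).
HB.instance Definition _ (d : nat) := isPointed.Build (Zd d) 0.
HB.instance Definition _ (d : nat) := @isMeasurable.Build default_measure_display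
  (Zd d) (@discrete_measurable (Zd d)) (@discrete_measurable0 (Zd d))
  (@discrete_measurableC (Zd d)) (@discrete_measurableU (Zd d)).

Definition zcoord (d : nat) (y : Zd d) (i : 'I_d) : int := (y : 'rV[int]_d) ord0 i.

Section averages.
Context (R : realType) (d : nat).
Implicit Types (f : Zd d -> R[i]) (t : R) (x : Zd d) (p : \bar R).

(* The lattice points of the cube [-t, t]^d. *)
Definition Qlat t : set (Zd d) :=
  [set y | forall i : 'I_d, (zcoord y i)%:~R \in `[- t, t]].

(* Sums and cardinals over Qlat t below are genuine, not default values. *)
Lemma finite_Qlat t : finite_set (Qlat t).
Proof.
set N := (Num.truncn t).+1.
pose g (h : {ffun 'I_d -> 'I_(N + N).+1}) : Zd d :=
  (\row_(i < d) ((h i : nat)%:Z - N%:Z)).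
apply: (@sub_finite_set _ _ (g @` [set: {ffun 'I_d -> 'I_(N + N).+1}])).
  move=> y Qy /=.
  have yN i : `|zcoord y i| <= N%:Z.
    rewrite -(ler_int R) intr_norm.
    have := Qy i; rewrite in_itv /= -ler_norml => /le_trans; apply.
    by rewrite ltW// -pmulrn truncnS_gt.
  have ge0 i : 0 <= zcoord y i + N%:Z.
    by have := yN i; rewrite ler_norml => /andP[h _]; rewrite -lerBlDr sub0r.
  exists [ffun i => inord (absz (zcoord y i + N%:Z))] => //.
  apply/rowP => i; rewrite mxE ffunE inordK.
    by rewrite gez0_abs// addrK.
  rewrite ltnS -lez_nat gez0_abs// PoszD lerD2r.
  by rewrite (le_trans (ler_norm _)).
exact/finite_image/finite_finset.
Qed.

Definition cube_avg t f x : R[i] :=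
  (#|` fset_set (Qlat t)|%:R)^-1 * \sum_(y \in Qlat t) f (x - y).

(* Normc.normc is the R-valued modulus; the norm `|z| of R[i] is R[i]-valued. *)
Definition dyadic_max f (x : Zd d) : \bar R :=
  ereal_sup [set (Normc.normc (cube_avg (2 ^+ n) f x))%:E | n in [set: nat]].

Definition lpnorm p (g : Zd d -> \bar R) : \bar R := Lnorm (@counting (Zd d) R) p g.

Definition abs_fun f (x : Zd d) : \bar R := (Normc.normc (f x))%:E.

Definition in_lp p f : Prop := (lpnorm p (abs_fun f) < +oo)%E.

End averages.

(* Main.v *)
Require Import Defs.
From HB Require Import structures.
From mathcomp Require Import all_boot all_order all_algebra.
From mathcomp Require Import complex finmap.
From mathcomp Require Import all_classical all_reals all_analysis.
From mathcomp Require Import ess_sup_inf.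
From mathcomp Require Import ring lra zify.
Set Implicit Arguments.
Unset Strict Implicit.
Unset Printing Implicit Defensive.
Import Order.TTheory GRing.Theory Num.Theory.
Import numFieldNormedType.Exports.
Local Open Scope classical_set_scope.
Local Open Scope ring_scope.

(** Why the theorem is true.

For p = +oo an average never exceeds the supremum, so let 1 < p < +oo.  Only
finitely many points and scales matter at a time, and they do not see the
difference between Z^d and the torus (Z/2^K)^d for K large
([finite_maximal]).  On the torus the average M_n over the cube
[-2^n, 2^n]^d is compared with F_k, the mean over all translates of the dyadic
grid of the conditional expectation onto the dyadic blocks of side 2^k.

The operators F_k inherit dimension-free bounds from martingale theory, where
dimension plays no role: the maximal function of the F_k is dominated by a mean
of Doob maximal functions ([doob_strong]), and the differences
S_m = F_m - F_(m+1) obey a square function estimate with a negative power of the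
Doob maximal function as a weight ([energy]).

The differences D_n = M_n - F_(n+1) are small on l^2 by Fourier analysis.  Let X
be the sum over the coordinates of |1 - z_j|^2, where (z_j) is the tuple of
roots of unity that defines a character, and s = 2^n sqrt X.  The multipliers of
D_n and S_n are bounded by C min(s, 1/s), apart from the decay of S_0.  The
constant does not depend on d because the decay of a one-dimensional multiplier
V over M points can be put in the form |V|^2 (1 + c M^2 |1 - z|^2) <= 1
([mean_decay]), which survives products since the product of the 1 + b_j is at
least 1 + sum b_j ([prod_decay]).  Hence D_n S_m has l^2 norm O(2^-|n-m|), and
the squares of all D_n S_m f remain summable with the weight (3/2)^|n-m|
([l2_bound]).

To leave l^2, fix 1 < q < 2 and let B be the best constant in
sum (Astar 1_E)^q <= B |E| over all sets E, where Astar is the maximal operator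
of all the M_n and F_(n+1), n < N; B is finite because the torus is.  By
interpolation, Astar is bounded on l^r for r > q with norm^r at most C B
([interpolation]).  If u is a weight and v = Astar u, then
(A g)^2 <= A (g^2 / u) A u <= A (g^2 / u) v for each averaging operator A among
them, so D_n maps l^2(1/u) to l^2(1/v) boundedly; applied to g = S_m 1_E and the
weight u of the square function estimate, this controls D_n S_m 1_E in l^2(1/v)
by |E|, without decay in |n-m|.  Interpolating pointwise with the decaying
unweighted bound gives
|D_n 1_E|^q <= C B^(1 - q/2) (H_1 + H_2 / v + v^r / B), where each of the three
terms sums to O(|E|) ([pointwise_holder]).  Since Astar 1_E is at most
max |D_n 1_E| plus a mean of Doob maximal functions, B <= C B^(1 - q/2)
([bootstrap_step]), so that B is bounded ([restricted_maximal]), and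
interpolation reaches all p > 1 ([torus_maximal]). *)

(** * Elementary sums and powers *)

Section Elementary.
Context {R : realType}.
Implicit Types (x y t : R).

(** Both halves of the sum are geometric, with ratio B up to the index where
B^i t crosses 1 and ratio 1/B after it. *)
Lemma sum_min_le (B t : R) (I : nat) : 1 < B -> 0 < t ->
  \sum_(i < I) Num.min (B ^+ i * t) (B ^+ i * t)^-1 <= 2 * B / (B - 1).
Proof.
move=> B1; set k := B / (B - 1).
have B10 : 0 < B - 1 by rewrite subr_gt0.
have kE : k * (B - 1) = B by rewrite /k divfK// gt_eqF.
have k0 : 1 < k by rewrite /k ltr_pdivlMr//; lra.
rewrite -mulrA -/k.
(* The bound 2k - kt for t < 1 is what makes the induction, which replaces t by
   B t, close on both sides of the crossing. *)
suff H : forall t, 0 < t -> \sum_(i < I) Num.min (B ^+ i * t) (B ^+ i * t)^-1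
    <= (if 1 <= t then k / t else 2 * k - k * t).
  move=> t0; apply: (le_trans (H t t0)); case: ifPn => [t1|_]; last nra.
  by rewrite ler_pdivrMr//; nra.
elim: I => [|I IH] {}t t0.
  rewrite big_ord0; case: ifPn => [t1|]; first by rewrite divr_ge0//; lra.
  by rewrite -ltNge => t1; nra.
rewrite big_ord_recl expr0 mul1r.
have -> : \sum_(i < I) Num.min (B ^+ lift ord0 i * t) (B ^+ lift ord0 i * t)^-1
   = \sum_(i < I) Num.min (B ^+ i * (B * t)) (B ^+ i * (B * t))^-1.
  by apply: eq_bigr => i _; rewrite /= /bump /= add1n exprSr mulrA.
have Bt0 : 0 < B * t by nra.
have {}IH := IH _ Bt0.
set S := \sum_(i < I) _ in IH *.
case: ifPn => [t1|].
  have Bt1 : 1 <= B * t by nra.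
  rewrite Bt1 in IH.
  rewrite min_r; last by apply: (le_trans _ t1); rewrite invf_le1.
  have -> : k / t = t^-1 + k / (B * t).
    rewrite /k; field; rewrite !gt_eqF//; lra.
  by rewrite lerD2l.
rewrite -ltNge => t1.
rewrite min_l; last first.
  by apply: (le_trans (ltW t1)); rewrite invf_ge1 ?ltW.
move: IH; case: ifPn => [Bt1 IH|]; last by rewrite -ltNge => Bt1 IH; nra.
have E : k / (B * t) = (k - 1) / t.
  by rewrite /k; field; rewrite !gt_eqF//; lra.
rewrite E in IH.
apply: le_trans (lerD (lexx t) IH) _.
have : (k - 1) / t <= 2 * k - k * t - t; last lra.
rewrite ler_pdivrMr//.
have -> : (2 * k - k * t - t) * t = (k - 1) + (1 - t) * ((1 + k) * t - (k - 1)) by ring.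
have : 0 <= (1 + k) * t - (k - 1); last by nra.
have : (1 + k) * (B * t) - (k - 1) * B >= 0; last by nra.
have : (k - 1) * B = k by lra.
nra.
Qed.

Definition gap (n m : nat) : nat := ((n - m) + (m - n))%N.

Lemma sum_geom_le (x : R) (I : nat) : 0 <= x < 1 -> \sum_(i < I) x ^+ i <= (1 - x)^-1.
Proof.
move=> /andP[x0 x1]; have x10 : 0 < 1 - x by lra.
rewrite -[leRHS]mul1r ler_pdivlMr// mulrC.
have := subrX1 x I; have : 0 <= x ^+ I by rewrite exprn_ge0.
by set S := \sum_(i < I) _; lra.
Qed.

Lemma sum_gap_le (x : R) (n K : nat) : 0 <= x < 1 ->
  \sum_(m < K) x ^+ gap n m <= 2 / (1 - x).
Proof.
move=> x01; have /andP[x0 x1] := x01.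
suff H : \sum_(m < K) x ^+ gap n m <= (1 - x)^-1 + \sum_(i < n) x ^+ i.+1.
  apply: (le_trans H).
  have -> : 2 / (1 - x) = (1 - x)^-1 + (1 - x)^-1 by field; lra.
  rewrite lerD2l; apply: le_trans (sum_geom_le n x01).
  by apply: ler_sum => i _; rewrite exprS ler_piMl ?exprn_ge0// ltW.
elim: n K => [|n IH] K.
  rewrite big_ord0 addr0; apply: le_trans (sum_geom_le K x01).
  by apply: ler_sum => i _; rewrite /gap sub0n subn0 add0n.
case: K => [|K]; first by rewrite big_ord0 addr_ge0 ?sumr_ge0// ?invr_ge0 ?subr_ge0 ?(ltW x1)// => i _; rewrite exprn_ge0.
rewrite big_ord_recl [in leRHS]big_ord_recr /= /gap subn0 sub0n addn0.
by rewrite addrA [leLHS]addrC lerD2r; apply: le_trans (IH K).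
Qed.

Lemma dyadic_bracket (y : R) : 0 < y <= 1 ->
  exists i : nat, 2^-1 ^+ i.+1 < y <= 2^-1 ^+ i.
Proof.
move=> /andP[y0 y1].
have ex : exists i : nat, (2^-1 : R) ^+ i.+1 < y.
  exists (Num.truncn y^-1).
  rewrite exprVn -[ltRHS]invrK ltf_pV2 ?posrE ?invr_gt0// ?exprn_gt0//.
  apply: (lt_le_trans (truncnS_gt _)).
  by rewrite -natrX ler_nat ltnW// ltn_expl.
case: (ex_minnP ex) => i Hi Hmin; exists i; rewrite Hi /=.
case: i Hi Hmin => [|i] Hi Hmin; first by rewrite expr0.
rewrite leNgt; apply/negP => /Hmin; by rewrite ltnn.
Qed.

End Elementary.

Section Powers.
Context {R : realType}.
Implicit Types (x y t : R).

Lemma powR_exprn x (a : R) (i : nat) : 0 <= x -> (x ^+ i) `^ a = (x `^ a) ^+ i.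
Proof.
move=> x0; elim: i => [|i IH]; first by rewrite !expr0 powR1.
by rewrite !exprS powRM ?exprn_ge0// IH.
Qed.

Lemma powRV x (a : R) : 0 <= x -> (x^-1) `^ a = (x `^ a)^-1.
Proof. by move=> x0; rewrite -powR_inv1// -powRrM mulN1r powRN. Qed.

Lemma powRK x (a : R) : 0 <= x -> a != 0 -> (x `^ a) `^ a^-1 = x.
Proof. by move=> x0 a0; rewrite -powRrM mulfV// powRr1. Qed.

Lemma powRVK x (a : R) : 0 <= x -> a != 0 -> (x `^ a^-1) `^ a = x.
Proof. by move=> x0 a0; rewrite -powRrM mulVf// powRr1. Qed.

Lemma ler_powR2l (a x y : R) : 0 <= a -> 0 <= x -> x <= y -> x `^ a <= y `^ a.
Proof. by move=> a0 x0 xy; rewrite ge0_ler_powR// nnegrE (le_trans x0). Qed.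

Lemma powR_le1 x (a : R) : 0 <= a -> 0 <= x <= 1 -> x `^ a <= 1.
Proof. by move=> a0 /andP[x0 x1]; have := ler_powR2l a0 x0 x1; rewrite powR1. Qed.

Lemma powR_ge1 x (a : R) : 0 <= a -> 1 <= x -> 1 <= x `^ a.
Proof. by move=> a0 x1; have := ler_powR2l a0 ler01 x1; rewrite powR1. Qed.

Lemma powR_add x (a b : R) : 0 < x -> x `^ (a + b) = x `^ a * x `^ b.
Proof. by move=> x0; rewrite powRD// (gt_eqF x0) implybT. Qed.

(** The pointwise core of real interpolation.  With A^p the sum on the right, each
g_i is at most min(1, (2^i A)^(p/q)); since p/q > 1 the terms 2^-i g_i decay
geometrically on both sides of the index where 2^i A is about 1, where they are
about A. *)
Lemma interp_pointwise (q p : R) : 0 < q -> q < p ->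
  exists C : R, 0 < C /\ forall (I : nat) (g : 'I_I -> R),
    (forall i, 0 <= g i <= 1) ->
    (\sum_(i < I) 2^-1 ^+ i * g i) `^ p
      <= C * \sum_(i < I) (2^-1 ^+ i) `^ p * g i `^ q.
Proof.
move=> q0 qp; have p0 : 0 < p := lt_trans q0 qp.
pose tau := p / q; have tau1 : 1 < tau by rewrite /tau ltr_pdivlMr// mul1r.
pose e := Num.min (tau - 1) 1.
have e0 : 0 < e by rewrite /e lt_min ltr01 andbT; lra.
have e1 : e <= 1 by rewrite /e ge_min lexx orbT.
have et : e <= tau - 1 by rewrite /e ge_min lexx.
pose B : R := 2 `^ e.
have B1 : 1 < B by have := @gt0_ltr_powR R e e0 1 2; rewrite !nnegrE powR1; apply; lra.
have c0 : 0 < 2 * B / (B - 1) by rewrite divr_gt0//; lra.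
exists ((2 * B / (B - 1)) `^ p); split; first exact: powR_gt0.
move=> I g g01; set S := (X in _ <= _ * X).
have h0 (i : nat) : 0 < (2^-1 : R) ^+ i by rewrite exprn_gt0// invr_gt0.
have S_ge (i : 'I_I) : (2^-1 ^+ i) `^ p * g i `^ q <= S.
  rewrite /S (bigD1 i)//= lerDl sumr_ge0// => j _.
  by rewrite mulr_ge0 ?powR_ge0.
have : 0 <= S by rewrite sumr_ge0// => j _; rewrite mulr_ge0 ?powR_ge0.
rewrite le_eqVlt => /orP[/eqP S0|S0].
  have g0 i : g i = 0.
    have := S_ge i; rewrite -S0 pmulr_rle0 ?powR_gt0// => gq.
    have : g i `^ q == 0 by rewrite eq_le gq powR_ge0.
    by rewrite powR_eq0 => /andP[/eqP].
  rewrite -S0 mulr0 big1 ?powR0 ?gt_eqF// => i _.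
  by rewrite g0 mulr0.
pose A := S `^ p^-1.
have A0 : 0 < A by rewrite powR_gt0.
have ApS : A `^ p = S by rewrite powRVK ?gt_eqF// ltW.
have key (i : 'I_I) : 2^-1 ^+ i * g i
    <= A * Num.min (B ^+ i * A `^ e) (B ^+ i * A `^ e)^-1.
  have /andP[gi0 gi1] := g01 i.
  pose y := A / 2^-1 ^+ i.
  have y0 : 0 < y by rewrite divr_gt0.
  have -> : B ^+ i * A `^ e = y `^ e.
    rewrite /y powRM ?ltW ?invr_gt0// mulrC -exprVn invrK powR_exprn//.
  have hE : 2^-1 ^+ i = A / y by rewrite /y; field; rewrite !gt_eqF.
  have gy : g i <= y `^ tau.
    have : g i `^ q <= y `^ p.
      rewrite /y powRM; [|exact: ltW|by rewrite invr_ge0 ltW].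
      rewrite (powRV _ (ltW (h0 i))) ApS.
      by rewrite ler_pdivlMr ?powR_gt0// mulrC.
    move=> /(ler_powR2l (ltW (_ : 0 < q^-1)) (powR_ge0 _ _)).
    rewrite invr_gt0 => /(_ q0); rewrite powRK ?gt_eqF//.
    by rewrite -powRrM.
  rewrite hE -mulrA ler_pM2l// le_min; apply/andP; split; rewrite mulrC ler_pdivrMr//.
    have [y1|y1] := leP y 1.
      apply: (le_trans gy); have -> : tau = (tau - 1) + 1 by ring.
      rewrite powR_add// (powRr1 (ltW y0)) ler_pM2r//.
      by apply: ger_powR => //; rewrite y0.
    apply: (le_trans gi1); rewrite mulr_ege1//; last exact: ltW.
    by rewrite powR_ge1// ltW.
  rewrite -powRN -[X in _ * X]powRr1; last exact: ltW.
  rewrite -powR_add//.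
  have [y1|y1] := leP y 1.
    by apply: (le_trans gy); apply: ger_powR; rewrite ?y0//; lra.
  by apply: (le_trans gi1); apply: powR_ge1; lra.
rewrite -ApS -powRM; [|exact: ltW|exact: ltW].
apply: ler_powR2l; first exact: ltW.
  by rewrite sumr_ge0// => i _; have /andP[? _] := g01 i; rewrite mulr_ge0// ltW.
rewrite mulrC; apply: (le_trans (ler_sum _ (fun i _ => key i))).
by rewrite -mulr_sumr ler_pM2l// sum_min_le// powR_gt0.
Qed.

End Powers.

(** * Finite martingales *)

Lemma bracket_unif {R : realType} (T : finType) (g : T -> R) :
  (forall x, g x <= 1) -> exists (i : T -> nat) (I : nat), forall x,
  (i x < I)%N /\ (0 < g x -> 2^-1 ^+ (i x).+1 < g x <= 2^-1 ^+ i x).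
Proof.
move=> g1.
have /fin_all_exists[i Hi] : forall x, exists i : nat,
    0 < g x -> 2^-1 ^+ i.+1 < g x <= 2^-1 ^+ i.
  move=> x; have [g0|g0] := ltP 0 (g x); last by exists 0%N.
  by have [|i Hi] := @dyadic_bracket R (g x); [rewrite g0 g1|exists i].
exists i, (\max_x i x).+1 => x; split; last exact: Hi.
by rewrite ltnS; apply: leq_bigmax.
Qed.

Section Martingale.
Context {R : realType} {T : finType} {V : eqType} (pi : nat -> T -> V).
Implicit Types (f g h : T -> R) (x y : T).

(** Conditional expectation for the uniform measure.  The partition of level k is
given by a labelling pi k of the points, and partitions become coarser as k
grows, so time runs from large k to small k. *)
Definition cnd k f x : R :=
  (\sum_(y | pi k y == pi k x) f y) / #|[pred y | pi k y == pi k x]|%:R.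

Definition mmax K f x : R := \big[Num.max/0]_(k < K.+1) cnd k f x.

Lemma block_card_gt0 k x : 0 < #|[pred y | pi k y == pi k x]|%:R :> R.
Proof. by rewrite ltr0n; apply/card_gt0P; exists x; rewrite inE. Qed.

Lemma cnd_eq k f x y : pi k x = pi k y -> cnd k f x = cnd k f y.
Proof. by rewrite /cnd => ->. Qed.

Lemma cnd_ge0 k f : (forall x, 0 <= f x) -> forall x, 0 <= cnd k f x.
Proof. by move=> f0 x; rewrite divr_ge0// ?sumr_ge0 ?ler0n. Qed.

Lemma cnd_le k f g : (forall x, f x <= g x) -> forall x, cnd k f x <= cnd k g x.
Proof. by move=> fg x; rewrite ler_pM2r ?invr_gt0 ?block_card_gt0// ler_sum. Qed.

Lemma cnd1 k x : cnd k (fun=> 1) x = 1.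
Proof. by rewrite /cnd sumr_const divff// gt_eqF// block_card_gt0. Qed.

(** Conditional expectation is self-adjoint and fixes functions that are constant
on blocks. *)
Lemma sum_cnd k h f : (forall x y, pi k x = pi k y -> h x = h y) ->
  \sum_x h x * cnd k f x = \sum_x h x * f x.
Proof.
move=> hc; pose c x : R := #|[pred y | pi k y == pi k x]|%:R.
transitivity (\sum_x \sum_(y | pi k y == pi k x) h x * f y / c x).
  by apply: eq_bigr => x _; rewrite /cnd mulrA mulr_sumr mulr_suml.
rewrite (exchange_big_dep predT)//=; apply: eq_bigr => y _.
rewrite (eq_bigr (fun=> h y * f y / c y)); last first.
  by move=> x /eqP e; rewrite (hc _ _ e) /c e.
rewrite sumr_const -mulr_natr; set n := (X in _ * X).
have -> : n = c y by rewrite /n /c; congr (_%:R); apply: eq_card => x; rewrite !inE eq_sym.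
by rewrite divfK// gt_eqF// block_card_gt0.
Qed.

Lemma cnd_le_mmax K f k x : (k <= K)%N -> cnd k f x <= mmax K f x.
Proof.
rewrite -ltnS => kK.
by rewrite /mmax (bigD1 (Ordinal kK))//= le_max lexx.
Qed.

Lemma mmax_ge0 K f x : 0 <= mmax K f x.
Proof. exact: bigmax_ge_id. Qed.

Lemma mmax_le1 K f : (forall x, f x <= 1) -> forall x, mmax K f x <= 1.
Proof.
move=> f1 x; rewrite /mmax; elim/big_ind : _ => // [a b a1 b1|k _].
  by rewrite ge_max a1.
by rewrite -(cnd1 k x); apply: cnd_le.
Qed.

Hypothesis refine : forall k x y, pi k x = pi k y -> pi k.+1 x = pi k.+1 y.

Lemma refine_le j k x y : (j <= k)%N -> pi j x = pi j y -> pi k x = pi k y.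
Proof.
move=> /subnK <-; elim: (k - j)%N => // n IH /IH; rewrite addSn; exact: refine.
Qed.

(** Weak type (1,1).  The point x is charged to the coarsest level k at which the
conditional expectation exceeds lam; the set of points charged to k is a union of
blocks of level k, so on it the conditional expectation may be replaced by f. *)
Lemma doob_weak K f (lam : R) : 0 <= lam -> (forall x, 0 <= f x) ->
  \sum_x lam * (lam < mmax K f x)%R%:R <= \sum_x f x.
Proof.
move=> lam0 f0.
pose a (k : 'I_K.+1) x : bool := (lam < cnd k f x) &&
   [forall j : 'I_K.+1, (k < j)%N ==> (cnd j f x <= lam)].
have a1 x : \sum_(k < K.+1) (a k x)%:R <= 1 :> R.
  have [/existsP[k ak]|/existsPn na] := boolP [exists k, a k x]; last first.
    by rewrite big1// => k _; rewrite (negbTE (na k)).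
  rewrite (bigD1 k)//= ak big1 ?addr0// => j jk.
  case: (boolP (a j x)) => // aj.
  have /andP[a1 /forallP a2] := ak; have /andP[b1 /forallP b2] := aj.
  have h1 : (j <= k)%N.
    by rewrite leqNgt; apply/negP => /(implyP (a2 j)); rewrite leNgt b1.
  have h2 : (k <= j)%N.
    by rewrite leqNgt; apply/negP => /(implyP (b2 k)); rewrite leNgt a1.
  by case/eqP : jk; apply/val_inj/anti_leq; rewrite h1 h2.
have amax x : (lam < mmax K f x)%R%:R <= \sum_(k < K.+1) (a k x)%:R :> R.
  case: (boolP (lam < mmax K f x)) => [lm|_]; last by rewrite sumr_ge0.
  have [k0 k0P] : exists k : 'I_K.+1, lam < cnd k f x.
    apply/existsP; apply: contraLR lm => /existsPn H; rewrite -leNgt.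
    rewrite /mmax; elim/big_ind : _ => // [u v u1 v1|k _]; first by rewrite ge_max u1.
    by rewrite leNgt.
  case: (@arg_maxnP _ k0 (fun k : 'I_K.+1 => lam < cnd k f x) (fun k => k : nat) k0P) => k kP kM.
  have ak : a k x.
    rewrite /a kP; apply/forallP => j; apply/implyP => kj.
    by rewrite leNgt; apply: contraTN kj => /kM; rewrite -leqNgt.
  by rewrite (bigD1 k)//= ak lerDl sumr_ge0.
have step (k : 'I_K.+1) : \sum_x lam * (a k x)%:R <= \sum_x (a k x)%:R * f x.
  rewrite -[leRHS](@sum_cnd k); last first.
    move=> x y e; rewrite /a (cnd_eq f e); congr (_ && _)%:R.
    apply: eq_forallb => j; case: ltnP => //= kj.
    by rewrite (cnd_eq f (refine_le (ltnW kj) e)).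
  apply: ler_sum => x _; rewrite /a; case: ltP => //= [/ltW l|_]; last by rewrite mulr0 mul0r.
  by rewrite mulrC ler_wpM2l.
have : \sum_x lam * (lam < mmax K f x)%R%:R <= \sum_(k < K.+1) \sum_x lam * (a k x)%:R.
  rewrite exchange_big/=; apply: ler_sum => x _.
  by rewrite -mulr_sumr ler_wpM2l.
move/le_trans; apply; apply: (le_trans (ler_sum _ (fun k _ => step k))).
rewrite exchange_big/=; apply: ler_sum => x _.
by rewrite -mulr_suml ler_piMl.
Qed.

(** Summing the Bregman divergences of the convex function
phi t = t^2 / (t + lam) along the martingale telescopes to at most the sum of
phi (f) <= f.  The divergence of phi at (s, t) is exactly
lam^2 (s - t)^2 / ((s + lam) (t + lam)^2), which avoids any analysis of real
powers. *)
Lemma energy_level K f (lam : R) : 0 < lam -> (forall x, 0 <= f x) ->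
  \sum_(k < K) \sum_x (cnd k f x - cnd k.+1 f x) ^+ 2 *
     (lam ^+ 2 / (mmax K f x + lam) ^+ 3) <= \sum_x f x.
Proof.
move=> lam0 f0; pose phi (t : R) := t ^+ 2 / (t + lam).
pose dphi (t : R) := 1 - (lam / (t + lam)) ^+ 2.
have zero (k : nat) : \sum_x dphi (cnd k.+1 f x) * (cnd k f x - cnd k.+1 f x) = 0.
  under eq_bigr do rewrite mulrBr; rewrite sumrB; apply/eqP; rewrite subr_eq0; apply/eqP.
  rewrite !sum_cnd// => x y e; first by rewrite (cnd_eq f e).
  by rewrite (cnd_eq f (refine e)).
have step (k : 'I_K) : \sum_x (cnd k f x - cnd k.+1 f x) ^+ 2 *
     (lam ^+ 2 / (mmax K f x + lam) ^+ 3) <= \sum_x phi (cnd k f x) - \sum_x phi (cnd k.+1 f x).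
  have -> : \sum_x phi (cnd k f x) - \sum_x phi (cnd k.+1 f x) =
      \sum_x (phi (cnd k f x) - phi (cnd k.+1 f x) -
               dphi (cnd k.+1 f x) * (cnd k f x - cnd k.+1 f x)).
    by rewrite !sumrB zero subr0.
  apply: ler_sum => x _.
  have := cnd_le_mmax f x (ltnW (ltn_ord k)); have := cnd_le_mmax f x (ltn_ord k).
  have := cnd_ge0 k f0 x; have := cnd_ge0 k.+1 f0 x.
  move: (cnd k f x) (cnd k.+1 f x) (mmax K f x) => u v m v0 u0 vm um.
  have -> : phi u - phi v - dphi v * (u - v) =
      (u - v) ^+ 2 * (lam ^+ 2 / ((u + lam) * (v + lam) ^+ 2)).
    by rewrite /phi /dphi; field; rewrite !gt_eqF//; lra.
  rewrite ler_wpM2l ?sqr_ge0// ler_wpM2l ?sqr_ge0// lef_pV2 ?posrE; last 2 first.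
  - by rewrite exprn_gt0//; lra.
  - by rewrite mulr_gt0 ?exprn_gt0//; lra.
  rewrite exprS ler_pM ?sqr_ge0 ?lerD2r//; first lra.
  by rewrite ler_sqr ?nnegrE ?lerD2r//; lra.
apply: (le_trans (ler_sum _ (fun k _ => step k))).
rewrite (eq_bigr (fun k : 'I_K => - (\sum_x phi (cnd k.+1 f x) - \sum_x phi (cnd k f x)))); last first.
  by move=> k _; rewrite opprB.
rewrite sumrN -(big_mkord xpredT (fun k => \sum_x phi (cnd k.+1 f x) - \sum_x phi (cnd k f x))).
rewrite telescope_sumr// opprB -[leRHS]addr0 lerD//; last first.
  rewrite oppr_le0 sumr_ge0// => x _; rewrite divr_ge0 ?sqr_ge0//.
  by rewrite addr_ge0 ?cnd_ge0// ltW.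
have -> : \sum_x f x = \sum_x cnd 0 f x.
  have := @sum_cnd 0 (fun=> 1) f (fun _ _ _ => erefl).
  by rewrite -!mulr_sumr !mul1r.
apply: ler_sum => x _; rewrite /phi; have := cnd_ge0 0 f0 x.
by move: (cnd 0 f x) => u u0; rewrite ler_pdivrMr; nra.
Qed.
End Martingale.

Section MartingaleBounds.
Context {R : realType}.

Lemma powR_gt1 (x a : R) : 0 < a -> 1 < x -> 1 < x `^ a.
Proof.
move=> a0 x1; have := @gt0_ltr_powR R a a0 1 x.
by rewrite !nnegrE powR1; apply=> //; lra.
Qed.

Lemma powR_half_lt1 (a : R) : 0 < a -> (2^-1 : R) `^ a < 1.
Proof.
move=> a0; have : 1 < (2 : R) `^ a by apply: powR_gt1 => //; lra.
by rewrite powRV// => h; rewrite invf_lt1//; lra.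
Qed.

(** For f <= 1 the exponent s > 1 makes the layers of [doob_weak] at heights 2^-i
summable. *)
Lemma doob_strong (s : R) : 1 < s -> exists C : R, 0 < C /\
  forall (T : finType) (V : eqType) (pi : nat -> T -> V),
  (forall k x y, pi k x = pi k y -> pi k.+1 x = pi k.+1 y) ->
  forall K (f : T -> R), (forall x, 0 <= f x <= 1) ->
  \sum_x (mmax pi K f x) `^ s <= C * \sum_x f x.
Proof.
move=> s1; pose w : R := 2 * (2^-1) `^ s.
have w1 : 0 <= w < 1.
  rewrite /w mulr_ge0 ?powR_ge0//=.
  have -> : s = 1 + (s - 1) by ring.
  rewrite powR_add ?invr_gt0// powRr1// mulrA divff ?pnatr_eq0// mul1r.
  by apply: powR_half_lt1; lra.
exists (2 * (1 - w)^-1); split; first by rewrite mulr_gt0// invr_gt0; lra.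
move=> T V pi refine K f f01.
have f0 x : 0 <= f x by have /andP[] := f01 x.
have f1 x : f x <= 1 by have /andP[] := f01 x.
have [i [I iP]] := bracket_unif (mmax_le1 pi K f1).
pose lam (j : nat) : R := 2^-1 ^+ j.+1.
have lam0 j : 0 <= lam j by rewrite exprn_ge0.
have pt x : mmax pi K f x `^ s <=
    \sum_(j < I) (2 * w ^+ j) * (lam j * (lam j < mmax pi K f x)%R%:R).
  have t0 (j : 'I_I) : 0 <= (2 * w ^+ j) * (lam j * (lam j < mmax pi K f x)%R%:R).
    by rewrite !mulr_ge0// exprn_ge0//; lra.
  have := mmax_ge0 pi K f x; rewrite le_eqVlt => /orP[/eqP e0|m0].
    by rewrite -{1}e0 powR0 ?sumr_ge0// gt_eqF//; lra.
  have [iI /(_ m0)/andP[h1 h2]] := iP x.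
  rewrite (bigD1 (Ordinal iI))//= ler_wpDr ?sumr_ge0//.
  rewrite /lam h1 mulr1.
  have s0 : 0 <= s by lra.
  apply: (le_trans (ler_powR2l s0 (ltW m0) h2)).
  rewrite powR_exprn// /w exprMn exprS.
  set A := _ `^ s ^+ _; have -> : 2 * (2 ^+ i x * A) * (2^-1 * 2^-1 ^+ i x) = A * ((2 * 2^-1) ^+ i x).
    by rewrite exprMn; field.
  by rewrite divff ?pnatr_eq0// expr1n mulr1.
apply: (le_trans (ler_sum _ (fun x _ => pt x))).
rewrite exchange_big/=.
apply: (@le_trans _ _ (\sum_(j < I) (2 * w ^+ j) * \sum_x f x)).
  apply: ler_sum => j _; rewrite -mulr_sumr ler_wpM2l ?doob_weak//.
  by rewrite mulr_ge0// exprn_ge0//; lra.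
rewrite -mulr_suml -mulr_sumr ler_wpM2r ?sumr_ge0// ler_wpM2l//.
exact: sum_geom_le.
Qed.

(** Adding up [energy_level] over lam = 2^-i with weights lam^(1 - b) recovers the
power -b of the maximal function, since the level lam comparable with the
maximal function alone contributes a fixed multiple of it. *)
Lemma energy (b : R) : 0 < b -> b < 1 -> exists C : R, 0 < C /\
  forall (T : finType) (V : eqType) (pi : nat -> T -> V),
  (forall k x y, pi k x = pi k y -> pi k.+1 x = pi k.+1 y) ->
  forall K (f : T -> R), (forall x, 0 <= f x <= 1) ->
  \sum_(k < K) \sum_x (cnd pi k f x - cnd pi k.+1 f x) ^+ 2 * mmax pi K f x `^ (- b)
     <= C * \sum_x f x.
Proof.
move=> b0 b1; pose v : R := 2^-1 `^ (1 - b).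
have v01 : 0 <= v < 1 by rewrite powR_ge0 powR_half_lt1//; lra.
exists (16 * (1 - v)^-1); split; first by rewrite mulr_gt0// invr_gt0; lra.
move=> T V pi refine K f f01.
have f0 x : 0 <= f x by have /andP[] := f01 x.
have f1 x : f x <= 1 by have /andP[] := f01 x.
have [i [I iP]] := bracket_unif (mmax_le1 pi K f1).
pose lam (j : nat) : R := 2^-1 ^+ j.
have lam0 j : 0 < lam j by rewrite exprn_gt0// invr_gt0.
have pt x : mmax pi K f x `^ (- b) <=
    \sum_(j < I) (16 * v ^+ j) * (lam j ^+ 2 / (mmax pi K f x + lam j) ^+ 3).
  have mm := mmax_ge0 pi K f x.
  have t0 (j : 'I_I) : 0 <= (16 * v ^+ j) * (lam j ^+ 2 / (mmax pi K f x + lam j) ^+ 3).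
    have := lam0 j => lj.
    by rewrite !mulr_ge0 ?invr_ge0 ?exprn_ge0//; lra.
  move: mm; rewrite le_eqVlt => /orP[/eqP e0|m0].
    by rewrite -{1}e0 powR0 ?sumr_ge0// oppr_eq0 gt_eqF.
  have [iI /(_ m0)/andP[h1 h2]] := iP x.
  rewrite (bigD1 (Ordinal iI))//= ler_wpDr ?sumr_ge0//.
  have := lam0 (i x); rewrite /v -powR_exprn// -/(lam (i x)).
  move: h1; rewrite exprS -/(lam (i x)) in h2 *.
  move: (lam (i x)) (mmax pi K f x) m0 h2 => l m m0 ml lm l0.
  have E1 : m `^ (- b) <= 2 * l `^ (- b).
    rewrite !powRN ler_pdivlMr ?powR_gt0// mulrC ler_pdivrMr ?powR_gt0//.
    have : 2^-1 * l `^ b <= m `^ b; last lra.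
    apply: (@le_trans _ _ ((2^-1 * l) `^ b)); last by apply: ler_powR2l; nra.
    rewrite powRM//; last exact: ltW.
    rewrite ler_wpM2r ?powR_ge0// ger1_powR//; last exact: ltW.
    by lra.
  apply: (le_trans E1); rewrite powR_add// powRr1; last exact: ltW.
  have p0 : 0 <= l `^ (- b) := powR_ge0 _ _.
  have -> : 16 * (l * l `^ (- b)) * (l ^+ 2 / (m + l) ^+ 3) =
     l `^ (- b) * (16 * (l ^+ 3 / (m + l) ^+ 3)) by ring.
  rewrite mulrC ler_wpM2l//.
  have : (m + l) ^+ 3 <= (2 * l) ^+ 3 by rewrite lerXn2r ?nnegrE//; lra.
  move=> H; rewrite mulrA ler_pdivlMr ?exprn_gt0//; [nra|lra].
have E k x : (cnd pi k f x - cnd pi k.+1 f x) ^+ 2 * mmax pi K f x `^ (- b) <=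
   \sum_(j < I) (16 * v ^+ j) * ((cnd pi k f x - cnd pi k.+1 f x) ^+ 2 *
       (lam j ^+ 2 / (mmax pi K f x + lam j) ^+ 3)).
  apply: (le_trans (ler_wpM2l (sqr_ge0 _) (pt x))).
  by rewrite mulr_sumr; apply: ler_sum => j _; rewrite mulrCA.
apply: (@le_trans _ _ (\sum_(k < K) \sum_x \sum_(j < I) (16 * v ^+ j) *
   ((cnd pi k f x - cnd pi k.+1 f x) ^+ 2 *
       (lam j ^+ 2 / (mmax pi K f x + lam j) ^+ 3)))).
  by apply: ler_sum => k _; apply: ler_sum => x _; exact: E.
under eq_bigr => k _ do rewrite exchange_big/=.
rewrite exchange_big/=.
apply: (@le_trans _ _ (\sum_(j < I) (16 * v ^+ j) * \sum_x f x)).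
  apply: ler_sum => j _.
  under eq_bigr => k _ do rewrite -mulr_sumr.
  rewrite -mulr_sumr ler_wpM2l ?energy_level//.
  by rewrite mulr_ge0// exprn_ge0//; lra.
rewrite -mulr_suml -mulr_sumr ler_wpM2r ?sumr_ge0// ler_wpM2l//.
exact: sum_geom_le.
Qed.
End MartingaleBounds.

(** * One-dimensional Fourier multipliers *)

Section UnitCircle.
Local Open Scope complex_scope.
Local Open Scope ring_scope.
Context {R : realType}.
Notation C := R[i].
Local Notation nc := (@Normc.normc R).
Local Notation Re := (@complex.Re R).
Local Notation Im := (@complex.Im R).
Implicit Types (z w : C).

Lemma sumr_const_ord (c : R) (n : nat) : \sum_(i < n) c = n%:R * c.
Proof. by rewrite sumr_const card_ord mulr_natl. Qed.

Lemma nc_sq z : nc z ^+ 2 = Re z ^+ 2 + Im z ^+ 2.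
Proof. by case: z => a b /=; rewrite sqr_sqrtr// addr_ge0 ?sqr_ge0. Qed.

Lemma nc_ge0 z : 0 <= nc z.
Proof. by case: z => a b /=; exact: sqrtr_ge0. Qed.

Lemma ncX z n : nc (z ^+ n) = nc z ^+ n.
Proof.
elim: n => [|n IH]; first exact: Normc.normc1.
by rewrite !exprS Normc.normcM IH.
Qed.

Lemma nc_real (x : R) : nc x%:C = `|x|.
Proof. by rewrite /= expr0n/= addr0 sqrtr_sqr. Qed.

Lemma nc_nat (n : nat) : nc n%:R = n%:R.
Proof. by rewrite -(rmorph_nat (real_complex R)) nc_real normr_nat. Qed.

Lemma ncV_nat (n : nat) : nc n%:R^-1 = n%:R^-1.
Proof. by rewrite Normc.normcV nc_nat. Qed.

Lemma nc_sum (I : Type) (r : seq I) (P : pred I) (F : I -> C) :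
  nc (\sum_(i <- r | P i) F i) <= \sum_(i <- r | P i) nc (F i).
Proof.
elim/big_ind2 : _ => [|x a y b xa yb|//]; first by rewrite Normc.normc0.
exact: le_trans (le_normcD _ _) (lerD xa yb).
Qed.

Lemma ncB z w : nc (z - w) = nc (w - z).
Proof. by rewrite -normcN opprB. Qed.

Lemma nc_dist w z u : nc (z - u) <= nc (z - w) + nc (w - u).
Proof. by rewrite (_ : z - u = (z - w) + (w - u)) ?le_normcD//; ring. Qed.

Lemma nc_conj z : z * conjc z = (nc z ^+ 2)%:C.
Proof.
rewrite nc_sq; case: z => a b /=; apply/eqP; rewrite eq_complex /=.
by apply/andP; split; apply/eqP; ring.
Qed.

Lemma nc_conjc z : nc (conjc z) = nc z.
Proof. by case: z => a b /=; rewrite sqrrN. Qed.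

Lemma unit_expr_dist z (n : nat) : nc z = 1 -> nc (1 - z ^+ n) <= n%:R * nc (1 - z).
Proof.
move=> z1; elim: n => [|n IH]; first by rewrite expr0 subrr Normc.normc0 mul0r.
apply: (le_trans (nc_dist (z ^+ n) _ _)).
rewrite -natr1 mulrDl mul1r lerD// -{1}[z ^+ n]mul1r exprS -mulrBl Normc.normcM.
by rewrite ncX z1 expr1n mulr1.
Qed.

Lemma unit_expr_dist2 z (n m : nat) : nc z = 1 ->
  nc (z ^+ n - z ^+ m) <= ((n - m) + (m - n))%:R * nc (1 - z).
Proof.
move=> z1; wlog nm : n m / (n <= m)%N => [H|].
  have /orP[nm|nm] := leq_total n m; first exact: H.
  by rewrite ncB addnC H.
rewrite (_ : z ^+ n - z ^+ m = z ^+ n * (1 - z ^+ (m - n))); last first.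
  by rewrite mulrBr mulr1 -exprD subnKC.
rewrite Normc.normcM ncX z1 expr1n mul1r.
have /eqP -> : (n - m == 0)%N by rewrite subn_eq0.
exact: unit_expr_dist.
Qed.

Lemma sum_variance (M : nat) (a : 'I_M -> R) : (0 < M)%N ->
  let m := M%:R^-1 * \sum_k a k in
  \sum_k (a k - m) ^+ 2 = \sum_k a k ^+ 2 - M%:R * m ^+ 2.
Proof.
move=> M0 m.
have E : \sum_k a k = M%:R * m by rewrite /m mulVKf// pnatr_eq0 -lt0n.
under eq_bigr do rewrite sqrrB.
rewrite big_split sumrB /= -mulr_natl.
rewrite sumr_const card_ord -mulr_natl.
have -> : \sum_k a k * m *+ 2 = 2 * M%:R * m ^+ 2.
  by rewrite sumrMnl -mulr_suml E; ring.
ring.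
Qed.

(** The Fourier multiplier of the average over {0, ..., M - 1}. *)
Definition mean z (M : nat) : C := M%:R^-1 * \sum_(k < M) z ^+ k.

Lemma ReD (x y : C) : Re (x + y) = Re x + Re y.
Proof. by case: x; case: y. Qed.
Lemma ImD (x y : C) : Im (x + y) = Im x + Im y.
Proof. by case: x; case: y. Qed.
Lemma Re_sum (M : nat) (F : 'I_M -> C) : Re (\sum_k F k) = \sum_k Re (F k).
Proof. by elim/big_rec2 : _ => // k x y _ <-; rewrite ReD. Qed.
Lemma Im_sum (M : nat) (F : 'I_M -> C) : Im (\sum_k F k) = \sum_k Im (F k).
Proof. by elim/big_rec2 : _ => // k x y _ <-; rewrite ImD. Qed.
Lemma ReM_real (c : R) (x : C) : Re (c%:C * x) = c * Re x.
Proof. by case: x => a b /=; rewrite mul0r subr0. Qed.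
Lemma ImM_real (c : R) (x : C) : Im (c%:C * x) = c * Im x.
Proof. by case: x => a b /=; rewrite mul0r addr0. Qed.
Lemma natCV (M : nat) : (M%:R^-1 : C) = (M%:R^-1 : R)%:C.
Proof. by rewrite fmorphV rmorph_nat. Qed.

(** The numbers z^k have modulus 1 and mean value [mean z M]. *)
Lemma mean_variance z (M : nat) : nc z = 1 -> (0 < M)%N ->
  \sum_(k < M) nc (z ^+ k - mean z M) ^+ 2 = M%:R * (1 - nc (mean z M) ^+ 2).
Proof.
move=> z1 M0.
have ReE : Re (mean z M) = M%:R^-1 * \sum_(k < M) Re (z ^+ k).
  by rewrite /mean natCV ReM_real Re_sum.
have ImE : Im (mean z M) = M%:R^-1 * \sum_(k < M) Im (z ^+ k).
  by rewrite /mean natCV ImM_real Im_sum.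
under eq_bigr => k _ do rewrite nc_sq.
have -> : \sum_(k < M) (Re (z ^+ k - mean z M) ^+ 2 + Im (z ^+ k - mean z M) ^+ 2)
   = \sum_(k < M) (Re (z ^+ k) - M%:R^-1 * \sum_(k < M) Re (z ^+ k)) ^+ 2
   + \sum_(k < M) (Im (z ^+ k) - M%:R^-1 * \sum_(k < M) Im (z ^+ k)) ^+ 2.
  rewrite -big_split/=; apply: eq_bigr => k _; rewrite -ReE -ImE.
  by case: (z ^+ k); case: (mean z M).
rewrite !sum_variance// -ReE -ImE nc_sq.
have : \sum_(k < M) Re (z ^+ k) ^+ 2 + \sum_(k < M) Im (z ^+ k) ^+ 2 = M%:R.
  rewrite -big_split/= (eq_bigr (fun=> 1)); first by rewrite sumr_const card_ord.
  by move=> k _; rewrite -nc_sq ncX z1 !expr1n.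
lra.
Qed.

Lemma mean_le1 z M : nc z = 1 -> (0 < M)%N -> nc (mean z M) <= 1.
Proof.
move=> z1 M0; rewrite /mean Normc.normcM ncV_nat ler_pdivrMl ?ltr0n// mulr1.
apply: (le_trans (nc_sum _ _ _)); rewrite (eq_bigr (fun=> 1)).
  by rewrite sumr_const card_ord.
by move=> k _; rewrite ncX z1 expr1n.
Qed.

Lemma mean_geom z M : (0 < M)%N -> M%:R * nc (mean z M) * nc (1 - z) = nc (1 - z ^+ M).
Proof.
move=> M0; rewrite -(nc_nat M) -!Normc.normcM /mean mulVKf ?pnatr_eq0 -?lt0n//.
by rewrite -[RHS]normcN opprB subrX1 -[LHS]normcN; congr nc; ring.
Qed.

Lemma mean_near1 z M : nc z = 1 -> (0 < M)%N ->
  1 - nc (mean z M) ^+ 2 <= M%:R ^+ 2 * nc (1 - z) ^+ 2.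
Proof.
move=> z1 M0; have M0' : 0 < M%:R :> R by rewrite ltr0n.
rewrite -(ler_pM2l M0') -mean_variance//.
rewrite -sumr_const_ord; apply: ler_sum => k _.
rewrite -exprMn ler_sqr ?nnegrE ?nc_ge0//; last by rewrite mulr_ge0 ?nc_ge0.
have -> : z ^+ k - mean z M = M%:R^-1 * \sum_(l < M) (z ^+ k - z ^+ l).
  by rewrite sumrB sumr_const card_ord mulrBr -[z ^+ k *+ M]mulr_natl mulKf// pnatr_eq0 -lt0n.
rewrite Normc.normcM ncV_nat ler_pdivrMl// -sumr_const_ord.
apply: (le_trans (nc_sum _ _ _)); apply: ler_sum => l _.
apply: (le_trans (unit_expr_dist2 _ _ z1)); rewrite ler_wpM2r ?nc_ge0// ler_nat.
by have := ltn_ord k; have := ltn_ord l; lia.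
Qed.

Lemma sum_ord_shift (F : nat -> R) (M h i : nat) : (forall k, 0 <= F k) ->
  (i + h <= M)%N -> \sum_(k < h) F (i + k)%N <= \sum_(k < M) F k.
Proof.
move=> F0 ihM.
rewrite -(big_mkord xpredT F) (@big_cat_nat _ _ _ i)//=; last by lia.
rewrite (@big_cat_nat _ _ _ (i + h)%N i M)//=; last by lia.
have -> : \sum_(i <= k < i + h) F k = \sum_(k < h) F (i + k)%N.
  rewrite -{1}(add0n i) big_addn addKn big_mkord.
  by apply: eq_bigr => k _; rewrite addnC.
have A1 : 0 <= \sum_(0 <= k < i) F k by rewrite sumr_ge0.
have A2 : 0 <= \sum_(i + h <= k < M) F k by rewrite sumr_ge0.
lra.
Qed.

(** For each i < n both z^i and z^(h + i) are among the M terms, and their distance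
is |1 - z^h|; it is bounded by their distances to the mean. *)
Lemma step_variance z (M h n : nat) : nc z = 1 -> (0 < M)%N -> (h + n <= M)%N ->
  n%:R * nc (1 - z ^+ h) ^+ 2 <= 4 * (M%:R * (1 - nc (mean z M) ^+ 2)).
Proof.
move=> z1 M0 hnM; rewrite -mean_variance//.
pose F k := nc (z ^+ k - mean z M) ^+ 2.
have F0 k : 0 <= F k by exact: sqr_ge0.
have S1 := sum_ord_shift F0 hnM.
have S2 : \sum_(k < n) F (0 + k)%N <= \sum_(k < M) F k.
  by apply: sum_ord_shift => //; lia.
rewrite -/(\sum_(k < M) F k) -sumr_const_ord.
have : \sum_(k < n) nc (1 - z ^+ h) ^+ 2 <=
    \sum_(k < n) (2 * F (0 + k)%N + 2 * F (h + k)%N).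
  apply: ler_sum => k _; rewrite add0n.
  have : nc (1 - z ^+ h) <= nc (z ^+ k - mean z M) + nc (z ^+ (h + k) - mean z M).
    rewrite (ncB (z ^+ (h + k))); apply: le_trans (nc_dist _ _ _).
    have -> : z ^+ k - z ^+ (h + k) = (1 - z ^+ h) * z ^+ k by rewrite exprD; ring.
    by rewrite Normc.normcM ncX z1 expr1n mulr1.
  rewrite /F; have := nc_ge0 (1 - z ^+ h).
  move: (nc (1 - z ^+ h)) (nc (z ^+ k - mean z M)) (nc (z ^+ (h + k) - mean z M)) => c a b c0 cab.
  have : c ^+ 2 <= (a + b) ^+ 2 by rewrite ler_sqr ?nnegrE//; lra.
  by have := sqr_ge0 (a - b); lra.
move/le_trans; apply; rewrite big_split -!mulr_sumr/=.
lra.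
Qed.

(** Since M |mean| |1 - z| = |1 - z^M|, the claim is that |1 - z^M|^2 is at most 96
times the variance 1 - |mean|^2.  One reaches z^M from 1 by two steps of length
floor(M/2) and at most one step of length 1, and [step_variance] bounds each
step. *)
Lemma mean_decay z M : nc z = 1 -> (1 < M)%N ->
  nc (mean z M) ^+ 2 * (1 + M%:R ^+ 2 * nc (1 - z) ^+ 2 / 96) <= 1.
Proof.
move=> z1 M1; have M0 : (0 < M)%N by lia.
pose h := M./2.
have hM : M = (odd M + h.*2)%N by rewrite odd_double_half.
have h0 : (0 < h)%N by rewrite /h half_gt0.
set Va := 1 - nc (mean z M) ^+ 2.
have Va0 : 0 <= Va.
  by have := mean_le1 z1 M0; have := nc_ge0 (mean z M); rewrite /Va; nra.
have M0' : 0 < M%:R :> R by rewrite ltr0n.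
have A1 : nc (1 - z ^+ h) ^+ 2 <= 12 * Va.
  have : (h + h <= M)%N by lia.
  move/(step_variance z1 M0); rewrite -/Va => H.
  have : M%:R <= 3 * h%:R :> R by rewrite -natrM ler_nat; lia.
  move/(ler_wpM2r Va0) => H2.
  have hR : 0 < h%:R :> R by rewrite ltr0n.
  rewrite -(ler_pM2l hR); lra.
have A2 : nc (1 - z) ^+ 2 <= 8 * Va.
  have : (1 + M.-1 <= M)%N by lia.
  move/(step_variance z1 M0); rewrite -/Va expr1 => H.
  have : M%:R <= 2 * M.-1%:R :> R by rewrite -natrM ler_nat; lia.
  move/(ler_wpM2r Va0) => H2.
  have hR : 0 < M.-1%:R :> R by rewrite ltr0n; lia.
  rewrite -(ler_pM2l hR); lra.
have A3 : nc (1 - z ^+ M) <= 2 * nc (1 - z ^+ h) + nc (1 - z).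
  have -> : 1 - z ^+ M = (1 - z ^+ odd M) + z ^+ odd M * ((1 - z ^+ h) + z ^+ h * (1 - z ^+ h)).
    by rewrite {1}hM exprD -addnn exprD; ring.
  apply: (le_trans (le_normcD _ _)); rewrite addrC lerD//.
    rewrite Normc.normcM ncX z1 expr1n mul1r; apply: (le_trans (le_normcD _ _)).
    by rewrite Normc.normcM ncX z1 expr1n mul1r; lra.
  by case: (odd M); rewrite ?expr1// expr0 subrr Normc.normc0 nc_ge0.
have A4 : nc (1 - z ^+ M) ^+ 2 <= 96 * Va.
  have := nc_ge0 (1 - z ^+ M); have := nc_ge0 (1 - z ^+ h); have := nc_ge0 (1 - z).
  move: (nc (1 - z ^+ M)) (nc (1 - z ^+ h)) (nc (1 - z)) A1 A2 A3 => a b c A1 A2 A3 c0 b0 a0.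
  have : a ^+ 2 <= (2 * b + c) ^+ 2 by nra.
  have : (2 * b + c) ^+ 2 <= 6 * b ^+ 2 + 3 * c ^+ 2 by have := sqr_ge0 (b - c); lra.
  lra.
move: A4; rewrite -(mean_geom z M0) !exprMn /Va; lra.
Qed.

(** The Fourier multiplier of the average over {-N, ..., N}: on the unit circle the
conjugate is the inverse. *)
Definition cmean z (N : nat) : C := conjc z ^+ N * mean z (2 * N).+1.

(** The symmetry k -> -k makes the mean real, so that 1 - cmean is the mean of the
numbers 1 - Re w = |1 - w|^2 / 2, which are quadratic in |1 - z|. *)
Lemma cmean_near1 z N : nc z = 1 ->
  nc (1 - cmean z N) <= N%:R ^+ 2 * nc (1 - z) ^+ 2 / 2.
Proof.
move=> z1; set M := (2 * N).+1; pose zb := conjc z.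
have zzb : z * zb = 1 by rewrite nc_conj z1 expr1n.
have zb1 : nc zb = 1 by rewrite nc_conjc.
pose w k := z ^+ k * zb ^+ N.
have MN0 : M%:R != 0 :> C by rewrite pnatr_eq0.
have wE (k : 'I_M) : w (rev_ord k) = conjc (w k).
  rewrite /w rmorphM !rmorphXn /= -/zb [conjc zb]conjcK.
  have kM : (k <= 2 * N)%N by rewrite -ltnS.
  rewrite subSS; have [kN|Nk] := leqP k N.
    have -> : (2 * N - k = N + (N - k))%N by lia.
    rewrite exprD mulrAC -exprMn zzb expr1n mul1r.
    have -> : (z ^+ N = z ^+ (N - k) * z ^+ k) by rewrite -exprD subnK.
    by rewrite mulrCA -exprMn [zb * z]mulrC zzb expr1n mulr1.
  have -> : (zb ^+ N = zb ^+ (2 * N - k) * zb ^+ (k - N)) by rewrite -exprD; congr (_ ^+ _); lia.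
  rewrite mulrA -exprMn zzb expr1n mul1r.
  have -> : (zb ^+ k = zb ^+ (k - N) * zb ^+ N) by rewrite -exprD; congr (_ ^+ _); lia.
  by rewrite -mulrA -exprMn [zb * z]mulrC zzb expr1n mulr1.
have cE : cmean z N = M%:R^-1 * \sum_(k < M) w k.
  rewrite /cmean /mean mulrCA; congr (_ * _); rewrite mulr_sumr.
  by apply: eq_bigr => k _; rewrite mulrC.
have cE2 : cmean z N = M%:R^-1 * \sum_(k < M) conjc (w k).
  rewrite cE; congr (_ * _); rewrite (reindex_inj rev_ord_inj)/=.
  by apply: eq_bigr => k _; rewrite wE.
have w1 k : nc (w k) = 1 by rewrite /w Normc.normcM !ncX z1 zb1 !expr1n mulr1.
have key : 1 - cmean z N = M%:R^-1 * \sum_(k < M) ((nc (1 - w k) ^+ 2)%:C / 2).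
  have -> : 1 - cmean z N = ((1 - cmean z N) + (1 - cmean z N)) / 2 by field.
  rewrite {1}cE cE2; set S := \sum_(k < M) w k; set S' := \sum_(k < M) conjc _.
  have -> : (1 - M%:R^-1 * S + (1 - M%:R^-1 * S')) / 2 =
      M%:R^-1 * ((M%:R - S + (M%:R - S')) / 2) by field.
  congr (_ * _).
  have -> : M%:R = \sum_(k < M) (1 : C) by rewrite sumr_const card_ord.
  rewrite -!sumrB -big_split/= mulr_suml; apply: eq_bigr => k _; congr (_ / _).
  rewrite -nc_conj rmorphB rmorph1.
  have : w k * conjc (w k) = 1 by rewrite nc_conj w1 expr1n.
  by move=> e; rewrite mulrBr mulr1 mulrBl mul1r e; ring.
rewrite key Normc.normcM ncV_nat ler_pdivrMl ?ltr0n//.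
apply: (le_trans (nc_sum _ _ _)).
rewrite -sumr_const_ord; apply: ler_sum => k _.
rewrite Normc.normcM nc_real ger0_norm ?sqr_ge0// (ncV_nat 2) ler_wpM2r//.
rewrite -exprMn ler_sqr ?nnegrE ?nc_ge0//; last by rewrite mulr_ge0 ?nc_ge0.
have -> : nc (1 - w k) = nc (z ^+ N - z ^+ k).
  have -> : 1 - w k = zb ^+ N * (z ^+ N - z ^+ k).
    by rewrite mulrBr -exprMn [zb * z]mulrC zzb expr1n mulrC.
  by rewrite Normc.normcM ncX zb1 expr1n mul1r.
apply: (le_trans (unit_expr_dist2 _ _ z1)); rewrite ler_wpM2r ?nc_ge0// ler_nat.
by have := ltn_ord k; rewrite /M; lia.
Qed.

Lemma cmean_norm z N : nc z = 1 -> nc (cmean z N) = nc (mean z (2 * N).+1).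
Proof. by move=> z1; rewrite /cmean Normc.normcM ncX nc_conjc z1 expr1n mul1r. Qed.

End UnitCircle.

(** * Convolution and Fourier analysis on the torus *)

Section Torus.
Local Open Scope complex_scope.
Local Open Scope ring_scope.
Context {R : realType} (d l : nat).
Notation C := R[i].
Local Notation nc := (@Normc.normc R).
Local Notation L := l.+2.
(** The group (Z/L)^d for L = l.+2, the moduli for which the ordinals form a
ring. *)
Definition torus := {ffun 'I_d -> 'I_l.+2}.
HB.instance Definition _ := Finite.on torus.
HB.instance Definition _ := GRing.Zmodule.on torus.
Local Notation G := torus.
Implicit Types (f g k : G -> R) (x y t xi : G).

Definition conv k f x : R := \sum_t k t * f (x - t).

Variable (w : C).
Hypothesis wP : L.-primitive_root w.

(** The coordinate j of the character xi is the power xi j of a primitive root. *)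
Definition chi xi x : C := \prod_(j < d) (w ^+ xi j) ^+ x j.

Lemma prim_norm1 : nc w = 1.
Proof.
have := prim_expr_order wP => /(congr1 nc); rewrite ncX Normc.normc1 => /eqP.
by rewrite pexpr_eq1 ?nc_ge0// => /eqP.
Qed.

Lemma chiD xi x y : chi xi (x + y) = chi xi x * chi xi y.
Proof.
rewrite /chi -big_split/=; apply: eq_bigr => j _.
rewrite !ffunE/= expr_mod ?exprD//.
by rewrite -exprM mulnC exprM (prim_expr_order wP) expr1n.
Qed.

Lemma chi0 xi : chi xi 0 = 1.
Proof. by rewrite /chi big1// => j _; rewrite !ffunE/= expr0. Qed.

Lemma chi_norm xi x : nc (chi xi x) = 1.
Proof.
rewrite /chi; elim/big_rec : _ => [|j z _ IH]; first exact: Normc.normc1.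
by rewrite Normc.normcM IH mulr1 !ncX prim_norm1 !expr1n.
Qed.

Lemma chi_conj xi x : conjc (chi xi x) = chi xi (- x).
Proof.
have n0 : chi xi x != 0.
  by apply/eqP => e; have := chi_norm xi x; rewrite e Normc.normc0 => /esym/eqP; rewrite oner_eq0.
apply: (mulfI n0); rewrite nc_conj chi_norm expr1n.
by rewrite -chiD subrr chi0.
Qed.

Lemma chi_orth t : \sum_xi chi xi t = if t == 0 then #|G|%:R else 0.
Proof.
rewrite /chi; under eq_bigr => xi _ do under eq_bigr => j _ do rewrite -exprM mulnC exprM.
rewrite -(bigA_distr_bigA (fun j (a : 'I_L) => (w ^+ t j) ^+ a)).
case: ifPn => [/eqP ->|t0].
  rewrite (eq_bigr (fun=> (L%:R : C))); last first.
    move=> j _; rewrite (eq_bigr (fun=> 1)); first by rewrite sumr_const card_ord.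
    by move=> a _; rewrite ffunE expr0 expr1n.
  by rewrite prodr_const card_ord card_ffun !card_ord natrX.
have [j tj] : exists j, t j != 0.
  apply/existsP; apply: contraNT t0 => /existsPn H; apply/eqP/ffunP => j.
  by have := H j; rewrite negbK ffunE => /eqP.
rewrite (bigD1 j)//= [X in X * _](_ : _ = 0) ?mul0r//.
have wt : w ^+ t j - 1 != 0.
  rewrite subr_eq0 -(expr0 w) (eq_prim_root_expr wP) mod0n modn_small//.
apply: (mulfI wt); rewrite mulr0 -subrX1 -exprM mulnC exprM (prim_expr_order wP).
by rewrite expr1n subrr.
Qed.

Definition hat f xi : C := \sum_x (f x)%:C * chi xi x.

Lemma hat_conv k f xi : hat (conv k f) xi = hat k xi * hat f xi.
Proof.
rewrite /hat /conv.
under eq_bigr => x _ do rewrite rmorph_sum mulr_suml.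
rewrite exchange_big/= mulr_suml; apply: eq_bigr => t _.
rewrite (reindex_inj (addIr t))/= mulr_sumr; apply: eq_bigr => x _.
by rewrite addrK chiD rmorphM/=; ring.
Qed.

Lemma parseval f : \sum_xi nc (hat f xi) ^+ 2 = #|G|%:R * \sum_x f x ^+ 2.
Proof.
apply: (@complexI R); rewrite rmorph_sum/= rmorphM/= rmorph_nat rmorph_sum/=.
transitivity (\sum_xi \sum_x \sum_y ((f x)%:C * (f y)%:C) * chi xi (x - y)).
  apply: eq_bigr => xi _; rewrite -nc_conj /hat rmorph_sum mulr_suml/=.
  apply: eq_bigr => x _; rewrite mulr_sumr; apply: eq_bigr => y _.
  have -> : conjc ((f y)%:C * chi xi y) = (f y)%:C * chi xi (- y).
    rewrite -chi_conj -[in RHS]conjc_real; exact: (rmorphM (@conjc R)).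

  by rewrite chiD; ring.
rewrite exchange_big/= mulr_sumr; apply: eq_bigr => x _.
rewrite exchange_big/=.
have E y : \sum_j (f x)%:C * (f y)%:C * chi j (x - y) =
    if y == x then #|G|%:R * (f x ^+ 2)%:C else 0.
  rewrite -mulr_sumr chi_orth subr_eq0 eq_sym; case: eqP => [->|_]; last by rewrite mulr0.
  by rewrite -[(f x ^+ 2)%:C]/(real_complex R _) rmorphXn/=; ring.
by under eq_bigr do rewrite E; rewrite -big_mkcond/= big_pred1_eq.
Qed.

Lemma conv2_l2 k g f : \sum_x conv k (conv g f) x ^+ 2 =
  #|G|%:R^-1 * \sum_xi (nc (hat k xi) * nc (hat g xi)) ^+ 2 * nc (hat f xi) ^+ 2.
Proof.
have G0 : #|G|%:R != 0 :> R by rewrite pnatr_eq0 -lt0n; apply/card_gt0P; exists 0.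
apply: (mulfI G0); rewrite mulVKf// -parseval; apply: eq_bigr => xi _.
by rewrite !hat_conv !Normc.normcM mulrA exprMn.
Qed.

End Torus.

(** * Products of multipliers and almost orthogonality *)

Section Products.
Local Open Scope complex_scope.
Local Open Scope ring_scope.
Context {R : realType}.
Notation C := R[i].
Local Notation nc := (@Normc.normc R).

Lemma nc_prod (I : Type) (r : seq I) (F : I -> C) :
  nc (\prod_(i <- r) F i) = \prod_(i <- r) nc (F i).
Proof.
elim/big_rec2 : _ => [|i x y _ <-]; first exact: Normc.normc1.
exact: Normc.normcM.
Qed.

Lemma nc_prod_le1 (I : Type) (r : seq I) (F : I -> C) :
  (forall i, nc (F i) <= 1) -> nc (\prod_(i <- r) F i) <= 1.
Proof.
move=> F1; rewrite nc_prod; elim: r => [|i r IH]; first by rewrite big_nil.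
rewrite big_cons -[leRHS]mulr1 ler_pM ?nc_ge0//.
by rewrite prodr_ge0// => j _; exact: nc_ge0.
Qed.

Lemma nc_prod_near1 (I : Type) (r : seq I) (F : I -> C) :
  (forall i, nc (F i) <= 1) ->
  nc (1 - \prod_(i <- r) F i) <= \sum_(i <- r) nc (1 - F i).
Proof.
move=> F1; elim: r => [|i r IH]; first by rewrite !big_nil subrr Normc.normc0.
rewrite !big_cons.
have -> : 1 - F i * \prod_(j <- r) F j = (1 - F i) + F i * (1 - \prod_(j <- r) F j) by ring.
apply: (le_trans (le_normcD _ _)); rewrite lerD2l Normc.normcM.
by apply: le_trans IH; rewrite ler_piMl ?nc_ge0.
Qed.

(** This is where independence of the dimension comes from: the product of the
1 + b_i is at least 1 plus their sum. *)
Lemma prod_decay (I : Type) (r : seq I) (u b : I -> R) :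
  (forall i, 0 <= u i) -> (forall i, 0 <= b i) -> (forall i, u i * (1 + b i) <= 1) ->
  (\prod_(i <- r) u i) * (1 + \sum_(i <- r) b i) <= 1.
Proof.
move=> u0 b0 ub; elim: r => [|i r IH]; first by rewrite !big_nil addr0 mulr1.
rewrite !big_cons; have := ub i; have := u0 i; have := b0 i.
have : 0 <= \prod_(j <- r) u j by rewrite prodr_ge0.
have : 0 <= \sum_(j <- r) b j by rewrite sumr_ge0.
move: (\prod_(j <- r) u j) (\sum_(j <- r) b j) (u i) (b i) IH => P S v c PS S0 P0 c0 v0 vc.
have h1 : 0 <= v * (1 + c) by rewrite mulr_ge0//; lra.
have h2 : 0 <= P * (1 + S) by rewrite mulr_ge0//; lra.
apply: (@le_trans _ _ ((v * (1 + c)) * (P * (1 + S)))); last by rewrite -[leRHS]mulr1 ler_pM.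
have -> : v * (1 + c) * (P * (1 + S)) = v * P * (1 + (c + S)) + v * P * (c * S) by ring.
by rewrite lerDl !mulr_ge0.
Qed.

(** Here a n and b m are the absolute values of the multipliers of D_n and S_m, and
2^n t = s.  The upper bounds give a n * b m = O(2^-|n-m|).  Only one factor of
the square is spent on this decay; of the other one keeps a n, whose sum over n
is bounded. *)
Lemma almost_orth_sum (t : R) (N K : nat) (a b : nat -> R) : 0 < t ->
  (forall n, (n < N)%N -> 0 <= a n) -> (forall m, (m < K)%N -> 0 <= b m <= 1) ->
  (forall n, (n < N)%N -> a n <= 10 * (2 ^+ n * t)) ->
  (forall n, (n < N)%N -> a n <= 10 * (2 ^+ n * t)^-1) ->
  (forall m, (m < K)%N -> b m <= 10 * (2 ^+ m * t)) ->
  (forall m, (m < K)%N -> (0 < m)%N -> b m <= 10 * (2 ^+ m * t)^-1) ->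
  \sum_(n < N) \sum_(m < K) (3 / 2) ^+ gap n m * (a n * b m) ^+ 2 <= 320 * 100.
Proof.
move=> t0 a0 b01 aU aD bU bD.
have p2 (n : nat) : 0 < (2 : R) ^+ n by rewrite exprn_gt0.
have key (n : 'I_N) (m : 'I_K) : a n * b m <= 100 * (2^-1) ^+ gap n m.
  have an := a0 n (ltn_ord n); have /andP[bm _] := b01 m (ltn_ord m).
  have [mn|nm] := leqP m n.
    apply: (le_trans (ler_pM an bm (aD n (ltn_ord n)) (bU m (ltn_ord m)))).
    have -> : gap n m = (n - m)%N by rewrite /gap; lia.
    have -> : (2 : R) ^+ n = 2 ^+ (n - m) * 2 ^+ m by rewrite -exprD subnK.
    rewrite exprVn; rewrite le_eqVlt; apply/orP; left; apply/eqP; field.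
    by rewrite !(gt_eqF (p2 _)) gt_eqF.
  apply: (le_trans (ler_pM an bm (aU n (ltn_ord n)) (bD m (ltn_ord m) _))); first by lia.
  have -> : gap n m = (m - n)%N by rewrite /gap; lia.
  have -> : (2 : R) ^+ m = 2 ^+ (m - n) * 2 ^+ n by rewrite -exprD subnK//; lia.
  rewrite exprVn; rewrite le_eqVlt; apply/orP; left; apply/eqP; field.
  by rewrite !(gt_eqF (p2 _)) gt_eqF.
have key2 (n : 'I_N) (m : 'I_K) : (3 / 2) ^+ gap n m * (a n * b m) ^+ 2 <=
    100 * a n * (3 / 4) ^+ gap n m.
  have an := a0 n (ltn_ord n); have /andP[bm b1] := b01 m (ltn_ord m).
  have -> : (3 / 4 : R) = (3 / 2) * 2^-1 by field.
  rewrite [in leRHS]exprMn.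
  have -> : 100 * a n * ((3 / 2) ^+ gap n m * 2^-1 ^+ gap n m) =
    (3 / 2) ^+ gap n m * ((100 * 2^-1 ^+ gap n m) * a n) by ring.
  rewrite ler_wpM2l ?exprn_ge0// expr2 ler_pM ?mulr_ge0//.
  by rewrite ler_piMr.
apply: (@le_trans _ _ (\sum_(n < N) 800 * a n)).
  apply: ler_sum => n _; apply: (le_trans (ler_sum _ (fun m _ => key2 n m))).
  rewrite -mulr_sumr.
  have : \sum_(m < K) (3 / 4 : R) ^+ gap n m <= 8.
    have -> : (8 : R) = 2 / (1 - 3 / 4) by field.
    by apply: sum_gap_le; lra.
  have := a0 n (ltn_ord n); move: (\sum_(m < K) _) (a n) => S v v0 S8.
  have : v * S <= v * 8 by rewrite ler_wpM2l.
  lra.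
rewrite -mulr_sumr.
have : \sum_(n < N) a n <= 10 * \sum_(n < N) Num.min (2 ^+ n * t) (2 ^+ n * t)^-1.
  rewrite mulr_sumr; apply: ler_sum => n _.
  by rewrite /Num.min; case: ifP => _; [exact: aU|exact: aD].
have : \sum_(n < N) Num.min (2 ^+ n * t) (2 ^+ n * t)^-1 <= 4.
  have -> : (4 : R) = 2 * 2 / (2 - 1) by field.
  by apply: sum_min_le => //; lra.
lra.
Qed.

End Products.

(** * Cube averages and averaged dyadic grids *)

Section Kernels.
Local Open Scope complex_scope.
Local Open Scope ring_scope.
Context {R : realType} (d l K : nat).
Hypothesis LK : l.+2 = (2 ^ K)%N.
Notation C := R[i].
Local Notation nc := (@Normc.normc R).
Local Notation L := l.+2.
Local Notation G := (torus d l).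
Implicit Types (f g : G -> R) (x y t xi : G).

(** The image under iota of the uniform probability on I. *)
Definition kpush (I : finType) (iota : I -> G) t : R :=
  #|I|%:R^-1 * \sum_i (iota i == t)%:R.

Lemma conv_kpush (I : finType) (iota : I -> G) f x :
  conv (kpush iota) f x = #|I|%:R^-1 * \sum_i f (x - iota i).
Proof.
rewrite /conv /kpush; under eq_bigr => t _ do rewrite -mulrA mulr_suml.
rewrite -mulr_sumr exchange_big/=; congr (_ * _); apply: eq_bigr => i _.
rewrite (bigD1 (iota i))//= eqxx mul1r big1 ?addr0// => t.
by rewrite eq_sym => /negbTE ->; rewrite mul0r.
Qed.

Definition cube_pt n (i : {ffun 'I_d -> 'I_(2 * 2 ^ n).+1}) : G :=
  [ffun j => (i j)%:R - (2 ^ n)%:R].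

Definition kM n : G -> R := kpush (@cube_pt n).

(** The dyadic block of side 2^k that contains x. *)
Definition blk k x : {ffun 'I_d -> nat} := [ffun j => (x j %/ 2 ^ k)%N].

Lemma blk_refine k x y : blk k x = blk k y -> blk k.+1 x = blk k.+1 y.
Proof.
move=> /ffunP H; apply/ffunP => j; have := H j; rewrite !ffunE expnSr.
by rewrite !divnMA => ->.
Qed.

(** The kernel of F_k: the probability that y and y - t lie in the same block when
y is uniform, divided by the number of points of a block; see [conv_kF]. *)
Definition kF k t : R :=
  (#|G|%:R * (2 ^ k)%:R ^+ d)^-1 * \sum_y (blk k y == blk k (y - t))%:R.

Lemma sum_divn_modn (S : nmodType) (M : nat) (h : nat -> nat -> S) : (0 < M)%N ->
  forall Q, \sum_(a < Q * M) h (a %/ M)%N (a %% M)%N = \sum_(q < Q) \sum_(r < M) h q r.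
Proof.
move=> M0 Q; rewrite -(big_mkord xpredT (fun a => h (a %/ M)%N (a %% M)%N)).
rewrite big_nat_mul big_mkord; apply: eq_bigr => q _.
rewrite mulSn addnC -{1}(add0n (q * M)%N) big_addn addKn big_mkord.
by apply: eq_bigr => r _; rewrite addnC divnMDl// divn_small// addn0 modnMDl modn_small.
Qed.

Lemma sum_divn_modn_L (S : nmodType) k (h : nat -> nat -> S) : (k <= K)%N ->
  \sum_(a < L) h (a %/ 2 ^ k)%N (a %% 2 ^ k)%N =
  \sum_(q < 2 ^ (K - k)) \sum_(r < 2 ^ k) h q r.
Proof.
move=> kK; rewrite -sum_divn_modn ?expn_gt0// -expnD subnK// -LK.
by [].
Qed.

Lemma blk_prod (S : comNzRingType) k y z :
  (blk k y == blk k z)%:R = \prod_j (y j %/ 2 ^ k == z j %/ 2 ^ k)%N%:R :> S.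
Proof.
case: eqP => [/ffunP e|ne].
  by rewrite big1// => j _; have := e j; rewrite !ffunE => ->; rewrite eqxx.
have [j ej] : exists j, (y j %/ 2 ^ k != z j %/ 2 ^ k)%N.
  apply/existsP; apply: contra_notT ne => /existsPn H; apply/ffunP => j.
  by rewrite !ffunE; apply/eqP; have := H j; rewrite negbK.
by rewrite (bigD1 j)//= (negbTE ej) mul0r.
Qed.

Lemma blk_card k x : (k <= K)%N ->
  #|[pred y | blk k y == blk k x]|%:R = (2 ^ k)%:R ^+ d :> R.
Proof.
move=> kK; rewrite -sum1_card natr_sum big_mkcond/=.
under eq_bigr => y _ do rewrite -mulrb inE blk_prod.
rewrite -(bigA_distr_bigA (fun j (b : 'I_L) => (b %/ 2 ^ k == x j %/ 2 ^ k)%N%:R)).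
rewrite (eq_bigr (fun=> (2 ^ k)%:R)) ?prodr_const ?card_ord// => j _.
rewrite (sum_divn_modn_L (fun q _ => (q == x j %/ 2 ^ k)%N%:R))//.
have xj : (x j %/ 2 ^ k < 2 ^ (K - k))%N.
  by rewrite ltn_divLR ?expn_gt0// -expnD subnK// -LK.
rewrite (bigD1 (Ordinal xj))//= eqxx sumr_const_ord mulr1 big1 ?addr0// => q.
by move=> /eqP qx; rewrite big1// => r _; case: eqP => // e; case: qx; apply/val_inj.
Qed.

Lemma conv_kF k f x : (k <= K)%N -> conv (kF k) f x =
  #|G|%:R^-1 * \sum_(om : G) cnd blk k (fun y => f (y - om)) (x + om).
Proof.
move=> kK; rewrite /conv /kF.
under eq_bigr => t _ do rewrite -mulrA mulr_suml.
rewrite -mulr_sumr invfM -mulrA; congr (_ * _).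
rewrite exchange_big/= mulr_sumr (reindex_inj (addrI x))/=.
refine (eq_bigr _ _) => om _; rewrite /cnd blk_card// mulrC; congr (_ / _).
rewrite [RHS]big_mkcond [RHS](reindex_inj (inj_comp (addrI (x + om)) oppr_inj))/=.
apply: eq_bigr => t _; rewrite eq_sym.
have -> : x + om - t - om = x - t by rewrite addrAC addrK.
by case: eqP => _; rewrite ?mul1r ?mul0r.
Qed.

Variable (w : C).
Hypothesis wP : L.-primitive_root w.

Lemma zeta_norm xi j : nc (w ^+ xi j) = 1.
Proof. by rewrite ncX (prim_norm1 wP) expr1n. Qed.

Lemma hat_kpush (I : finType) (iota : I -> G) xi :
  hat w (kpush iota) xi = #|I|%:R^-1 * \sum_i chi w xi (iota i).
Proof.
rewrite /hat /kpush.
under eq_bigr => t _ do rewrite rmorphM/= rmorph_sum/= -mulrA mulr_suml.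
rewrite -mulr_sumr exchange_big/= natCV; congr (_ * _); apply: eq_bigr => i _.
rewrite (bigD1 (iota i))//= eqxx mul1r big1 ?addr0// => t.
by rewrite eq_sym => /negbTE ->; rewrite mul0r.
Qed.

Lemma hat_kM n xi : hat w (kM n) xi = \prod_j cmean (w ^+ xi j) (2 ^ n).
Proof.
rewrite hat_kpush card_ffun !card_ord /cmean /mean.
pose M := (2 * 2 ^ n).+1; pose F j (a : 'I_M) := conjc (w ^+ xi j) ^+ (2 ^ n) * (w ^+ xi j) ^+ a.
rewrite (eq_bigr (fun i : {ffun 'I_d -> 'I_M} => \prod_j F j (i j))).
  rewrite -(bigA_distr_bigA F) natrX -exprVn.
  rewrite -{1}[d]card_ord -prodr_const -big_split/=; apply: eq_bigr => j _.
  by rewrite /F -mulr_sumr mulrCA.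
move=> i _; rewrite /chi; apply: eq_bigr => j _; rewrite ffunE /F.
set z := w ^+ xi j; have z1 : nc z = 1 by exact: zeta_norm.
have zL : z ^+ L = 1 by rewrite -exprM mulnC exprM (prim_expr_order wP) expr1n.
have zz : conjc z * z = 1 by rewrite mulrC nc_conj z1 expr1n.
have add (a b : 'I_L) : z ^+ (a + b)%R = z ^+ a * z ^+ b.
  by rewrite /= expr_mod// exprD.
have nat (a : nat) : z ^+ (a%:R : 'I_L) = z ^+ a.
  by rewrite Zp_nat /= expr_mod.
rewrite -[LHS]mul1r -(expr1n _ (2 ^ n)) -zz exprMn -mulrA; congr (_ * _).
by rewrite -[z ^+ (2 ^ n)]nat -add addrC subrK nat.
Qed.

(** The multiplier counts pairs of points in the same block, block by block, and so
is the square of the modulus of the multiplier of one block. *)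
Lemma hat_kF k xi : (k <= K)%N ->
  hat w (kF k) xi = (\prod_j nc (mean (w ^+ xi j) (2 ^ k)) ^+ 2)%:C.
Proof.
move=> kK; rewrite /hat /kF.
pose F j (a b : 'I_L) : C := (a %/ 2 ^ k == b %/ 2 ^ k)%N%:R *
   ((w ^+ xi j) ^+ a * conjc ((w ^+ xi j) ^+ b)).
transitivity ((#|G|%:R * (2 ^ k)%:R ^+ d)^-1 * \sum_(y : G) \sum_(z : G) \prod_j F j (y j) (z j)).
  under eq_bigr => t _ do rewrite rmorphM/= rmorph_sum/= -mulrA mulr_suml.
  rewrite -mulr_sumr fmorphV rmorphM rmorphXn !rmorph_nat; congr (_ * _).
  rewrite exchange_big/=; apply: eq_bigr => y _.
  rewrite (reindex_inj (inj_comp (addrI y) oppr_inj))/=; apply: eq_bigr => z _.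
  rewrite opprD opprK addrA subrr add0r rmorph_nat blk_prod.
  rewrite (chiD wP) -(chi_conj wP) /chi.
  have -> : conjc (\prod_j (w ^+ xi j) ^+ z j) = \prod_j conjc ((w ^+ xi j) ^+ z j).
    exact: (rmorph_prod (@conjc R)).
  by rewrite -!big_split.
rewrite (eq_bigr (fun y : G => \prod_j \sum_b F j (y j) b)); last first.
  by move=> y _; rewrite bigA_distr_bigA.
rewrite -(bigA_distr_bigA (fun j a => \sum_b F j a b)) rmorph_prod/=.
have -> : (#|G|%:R * (2 ^ k)%:R ^+ d)^-1 = \prod_(j < d) (L%:R * (2 ^ k)%:R)^-1 :> C.
  by rewrite prodr_const card_ord exprVn exprMn card_ffun !card_ord natrX.
rewrite -big_split/=; apply: eq_bigr => j _.
set z := w ^+ xi j; have z1 : nc z = 1 by exact: zeta_norm.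
pose M := (2 ^ k)%N; have M0 : (0 < M)%N by rewrite expn_gt0.
have zz : z * conjc z = 1 by rewrite nc_conj z1 expr1n.
pose S := \sum_(r < M) z ^+ r.
have S2 : \sum_(r < M) conjc (z ^+ r) = conjc S by rewrite rmorph_sum.
have inner (a : 'I_L) : \sum_b F j a b = z ^+ (a %% M) * conjc S.
  pose h q r := ((a %/ M == q)%N%:R * (z ^+ a * conjc (z ^+ (q * M + r)))).
  rewrite (eq_bigr (fun b : 'I_L => h (b %/ M)%N (b %% M)%N)); last first.
    by move=> b _; rewrite /h /F -divn_eq.
  rewrite (sum_divn_modn_L h)//.
  have aj : (a %/ 2 ^ k < 2 ^ (K - k))%N.
    by rewrite ltn_divLR ?expn_gt0// -expnD subnK// -LK.
  rewrite (bigD1 (Ordinal aj))//= [X in _ + X]big1 ?addr0; last first.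
    move=> q /eqP qx; rewrite big1// => r _; rewrite /h; case: eqP => [e|_]; last by rewrite mul0r.
    by case: qx; apply/val_inj.
  rewrite -S2 mulr_sumr; apply: eq_bigr => r _; rewrite /h eqxx mul1r.
  rewrite exprD rmorphM {1}(divn_eq a M) exprD.
  have : z ^+ (a %/ M * M) * conjc (z ^+ (a %/ M * M)) = 1.
    by rewrite nc_conj ncX z1 !expr1n.
  by set u := z ^+ _; set v := conjc _; move=> uv; rewrite -[RHS]mul1r -uv; ring.
under eq_bigr => a _ do rewrite inner.
rewrite -mulr_suml (sum_divn_modn_L (fun _ r => z ^+ r))// -/S sumr_const card_ord.
have Lq : L%:R = (2 ^ (K - k))%:R * M%:R :> C by rewrite -natrM -expnD subnK// -LK.
rewrite -nc_conj /mean -/M -/S Lq -(mulr_natl S).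
have -> : conjc (M%:R^-1 * S) = M%:R^-1 * conjc S.
  by rewrite natCV -{2}(conjc_real M%:R^-1); exact: (rmorphM (@conjc R)).
have : M%:R != 0 :> C by rewrite pnatr_eq0 -lt0n.
have : (2 ^ (K - k))%:R != 0 :> C by rewrite pnatr_eq0 -lt0n expn_gt0.
move: (conjc S) => S'; move: (M%:R) ((2 ^ (K - k))%:R) => m q q0 m0.
by field; rewrite m0 q0.
Qed.

End Kernels.

(** * The square function estimate on l^2 *)

Section L2.
Local Open Scope complex_scope.
Local Open Scope ring_scope.
Context {R : realType}.
Notation C := R[i].
Local Notation nc := (@Normc.normc R).

Lemma root_of_minus1 n : exists w : C, w ^+ (2 ^ n) = -1.
Proof.
elim: n => [|n [w wn]]; first by exists (-1); rewrite expr1.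
by exists (sqrtc w); rewrite expnS exprM sqr_sqrtc.
Qed.

Lemma prim_root_pow2 n : exists w : C, (2 ^ n.+1).-primitive_root w.
Proof.
have [w wn] := root_of_minus1 n; exists w.
have w1 : w ^+ (2 ^ n.+1) = 1 by rewrite expnSr exprM wn sqrrN expr1n.
have [m mP] := prim_order_exists (expn_gt0 2 n.+1) w1.
case/(dvdn_pfactor _ _ (isT : prime 2)) => j; rewrite leq_eqVlt => /orP[/eqP -> <-//|].
rewrite ltnS => jn mE; have : w ^+ (2 ^ n) = 1.
  by rewrite -(subnKC jn) expnD exprM -mE (prim_expr_order mP) expr1n.
rewrite wn => /eqP; rewrite eq_sym -addr_eq0 => /eqP h.
by have := pnatr_eq0 C 2; rewrite mulr2n h eqxx.
Qed.

(** Turns the quadratic smallness at 0 of a bounded multiplier into the linear one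
that [almost_orth_sum] asks for. *)
Lemma min_quadratic (s c a B : R) : 0 < s -> 0 <= c -> 0 <= B ->
  a <= c * s ^+ 2 -> a <= B -> a <= (c + B) * s.
Proof.
move=> s0 c0 B0 a1 a2; have [s1|s1] := leP s 1; first by nra.
by nra.
Qed.

Lemma decay_sq (s m A : R) : 0 < s -> 0 <= A -> 0 <= m -> m ^+ 2 * s ^+ 2 <= A ^+ 2 -> m <= A * s^-1.
Proof.
move=> s0 A0 m0 h; rewrite ler_pdivlMr//.
by rewrite -ler_sqr ?nnegrE ?exprMn// mulr_ge0// ltW.
Qed.

Context (d l K : nat).
Hypothesis LK : l.+2 = (2 ^ K)%N.
Local Notation L := l.+2.
Local Notation G := (torus d l).
Implicit Types (f : G -> R) (x y t xi : G).

(** The kernels of D_n = M_n - F_(n+1) and S_m = F_m - F_(m+1).  The shift from n to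
n+1 matters: F_0 is the identity, whose multiplier does not decay. *)
Definition kD n t : R := @kM R d l n t - @kF R d l n.+1 t.
Definition kS m t : R := @kF R d l m t - @kF R d l m.+1 t.

Section WithRoot.
Variable (w : C).
Hypothesis wP : L.-primitive_root w.

Lemma hatB (k g : G -> R) xi : hat w (fun t => k t - g t) xi = hat w k xi - hat w g xi.
Proof. by rewrite /hat -sumrB; apply: eq_bigr => t _; rewrite rmorphB/= mulrBl. Qed.

(** All multipliers are functions of the quantity X and of the scale, up to
constants: 1 - M_n and 1 - F_k are O(4^n X) and O(4^k X), while |M_n|^2 and F_k
with k > 0 are O(1 / (4^n X)) and O(1 / (4^k X)). *)
Lemma multiplier_sum N xi : (N <= K)%N ->
  \sum_(n < N) \sum_(m < K) (3 / 2) ^+ gap n m *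
    (nc (hat w (kD n) xi) * nc (hat w (kS m) xi)) ^+ 2 <= 320 * 100.
Proof.
move=> NK.
pose z j := w ^+ xi j.
have z1 j : nc (z j) = 1 by rewrite /z ncX (prim_norm1 wP) expr1n.
pose X := \sum_j nc (1 - z j) ^+ 2.
have X0 : 0 <= X by rewrite sumr_ge0// => j _; rewrite sqr_ge0.
pose P k := \prod_j nc (mean (z j) (2 ^ k)) ^+ 2.
pose Q n := hat w (@kM R d l n) xi.
have u01 k j : (0 < k)%N -> 0 <= nc (mean (z j) k) ^+ 2 <= 1.
  by move=> k0; rewrite sqr_ge0/= expr_le1// ?nc_ge0// mean_le1.
have P01 k : 0 <= P k <= 1.
  rewrite /P; elim/big_ind : _ => [|u v /andP[u0 u1] /andP[v0 v1]|j _].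
  - by rewrite ler01 lexx.
  - by rewrite mulr_ge0//= mulr_ile1.
  - by rewrite u01// expn_gt0.
have P1 k : 1 - P k <= (2 ^+ k) ^+ 2 * X.
  have E (r : R) : nc (1 - r%:C) = `|1 - r| by rewrite -nc_real rmorphB.
  have H := @nc_prod_near1 R 'I_d (index_enum _) (fun j => (nc (mean (z j) (2 ^ k)) ^+ 2)%:C).
  have PE : \prod_j (nc (mean (z j) (2 ^ k)) ^+ 2)%:C = (P k)%:C.
    by rewrite /P rmorph_prod.
  rewrite PE E ger0_norm in H; last by rewrite subr_ge0; have /andP[] := P01 k.
  apply: (le_trans (H _)).
    by move=> j; rewrite nc_real ger0_norm ?sqr_ge0//; have /andP[] := u01 (2 ^ k)%N j (expn_gt0 _ _).
  rewrite /X mulr_sumr; apply: ler_sum => j _.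
  rewrite E ger0_norm ?subr_ge0; last by have /andP[] := u01 (2 ^ k)%N j (expn_gt0 _ _).
  by rewrite -natrX; apply: mean_near1; rewrite ?expn_gt0.
have PD k : (0 < k)%N -> P k * (1 + (2 ^+ k) ^+ 2 * X / 96) <= 1.
  move=> k0; rewrite /X mulr_sumr mulr_suml; apply: prod_decay => j.
  - exact: sqr_ge0.
  - by apply: divr_ge0; [apply: mulr_ge0; exact: sqr_ge0|exact: ler0n].
  - by rewrite -natrX; apply: mean_decay => //; rewrite -(expn0 2) ltn_exp2l.
have Q1 n : nc (1 - Q n) <= (2 ^+ n) ^+ 2 * X / 2.
  rewrite /Q (hat_kM wP).
  apply: (le_trans (nc_prod_near1 _ _)).
    by move=> j; rewrite (cmean_norm _ (z1 j)); apply: mean_le1 (z1 j) _.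
  rewrite /X mulr_sumr mulr_suml; apply: ler_sum => j _.
  rewrite -natrX; exact: (cmean_near1 _ (z1 j)).
have Q_le1 n : nc (Q n) <= 1.
  rewrite /Q (hat_kM wP); apply: nc_prod_le1 => j.
  by rewrite (cmean_norm _ (z1 j)); apply: mean_le1 (z1 j) _.
have QD n : nc (Q n) ^+ 2 * (1 + (2 ^+ n) ^+ 2 * X / 24) <= 1.
  rewrite /Q (hat_kM wP) nc_prod -prodrXl.
  rewrite /X mulr_sumr mulr_suml; apply: prod_decay => j.
  - exact: sqr_ge0.
  - by apply: divr_ge0; [apply: mulr_ge0; exact: sqr_ge0|exact: ler0n].
  - rewrite (cmean_norm _ (z1 j)).
    have := @mean_decay R (z j) (2 * 2 ^ n).+1 (z1 j).
    have n0 : (0 < 2 ^ n)%N by rewrite expn_gt0.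
    have -> : (1 < (2 * 2 ^ n).+1)%N by lia.
    move=> /(_ isT); apply: le_trans; rewrite ler_wpM2l ?sqr_ge0// lerD2l.
    have A : (2 * 2 ^+ n : R) <= (2 * 2 ^ n).+1%:R.
      by rewrite -natrX -natrM ler_nat.
    have p0 : 0 < (2 : R) ^+ n by rewrite exprn_gt0.
    have : (2 * 2 ^+ n : R) ^+ 2 <= (2 * 2 ^ n).+1%:R ^+ 2.
      by rewrite ler_sqr// nnegrE; lra.
    have := sqr_ge0 (nc (1 - w ^+ xi j)); rewrite -/(z j).
    move: (_.+1%:R ^+ 2) (nc (1 - z j) ^+ 2) => U V V0 HU.
    have : (2 * 2 ^+ n) ^+ 2 * V <= U * V by rewrite ler_wpM2r.
    by rewrite exprMn; lra.
have nD n : (n < N)%N -> hat w (kD n) xi = Q n - (P n.+1)%:C.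
  by move=> nN; rewrite hatB (hat_kF LK wP)// (leq_trans nN).
have nS m : (m < K)%N -> nc (hat w (kS m) xi) = `|P m - P m.+1|.
  move=> mK; rewrite hatB !(hat_kF LK wP)//; last exact: ltnW.
  by rewrite -nc_real rmorphB.
have Pabs k : nc (P k)%:C = P k by rewrite nc_real ger0_norm//; have /andP[] := P01 k.
have nP1 k : nc (1 - (P k)%:C) = 1 - P k.
  rewrite -[RHS]ger0_norm; last by have /andP[] := P01 k; rewrite subr_ge0.
  by rewrite -nc_real rmorphB.
have D1 n : (n < N)%N -> nc (hat w (kD n) xi) <= 5 * ((2 ^+ n) ^+ 2 * X).
  move=> nN; rewrite nD//; apply: (le_trans (nc_dist 1 _ _)).
  rewrite (ncB (Q n)) nP1.
  have := Q1 n; have := P1 n.+1; rewrite [2 ^+ n.+1]exprS exprMn.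
  have : 0 <= (2 ^+ n) ^+ 2 * X by rewrite mulr_ge0 ?sqr_ge0.
  lra.
(* The trivial character: D_n annihilates constants. *)
move: X0; rewrite le_eqVlt => /orP[/eqP X0|X0].
  apply: (@le_trans _ _ 0); last by apply: mulr_ge0; exact: ler0n.
  rewrite le_eqVlt; apply/orP; left; apply/eqP.
  apply: big1 => n _; apply: big1 => m _.
  have := D1 n (ltn_ord n); rewrite -X0 !mulr0 => h.
  have -> : nc (hat w (kD n) xi) = 0 by apply/eqP; rewrite eq_le h nc_ge0.
  by rewrite mul0r expr0n mulr0.
pose t := Num.sqrt X.
have t0 : 0 < t by rewrite sqrtr_gt0.
have sE (n : nat) : (2 ^+ n) ^+ 2 * X = (2 ^+ n * t) ^+ 2 by rewrite exprMn sqr_sqrtr// ltW.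
have s0 (n : nat) : 0 < 2 ^+ n * t by rewrite mulr_gt0// exprn_gt0.
have PDs k : (0 < k)%N -> P k * (2 ^+ k * t) ^+ 2 <= 96.
  by move=> k0; have := PD k k0; rewrite sE; have /andP[] := P01 k; lra.
have Ps k : (0 < k)%N -> P k <= 10 * (2 ^+ k * t)^-1.
  move=> k0; have /andP[p0 p1] := P01 k; apply: decay_sq => //.
  have := PDs k k0; have : 0 <= (2 ^+ k * t) ^+ 2 by exact: sqr_ge0.
  by move: (_ ^+ 2) => S S0 h; nra.
have Ps1 k : P k.+1 <= 5 * (2 ^+ k * t)^-1.
  have /andP[p0 p1] := P01 k.+1; apply: decay_sq => //.
  have := PDs k.+1 isT; have : 0 <= (2 ^+ k * t) ^+ 2 by exact: sqr_ge0.
  rewrite [2 ^+ k.+1]exprS -mulrA exprMn.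
  by move: ((2 ^+ k * t) ^+ 2) => S S0 h; nra.
apply: (@almost_orth_sum R t N K (fun n => nc (hat w (kD n) xi)) (fun m => nc (hat w (kS m) xi))) => //.
- by move=> n nN; exact: nc_ge0.
- move=> m mK; rewrite nc_ge0/= nS// ler_norml.
  by have /andP[] := P01 m; have /andP[] := P01 m.+1; lra.
- move=> n nN; have -> : (10 : R) = 5 + 5 by ring.
  apply: min_quadratic => //; first by rewrite -sE; exact: D1.
  rewrite nD//; apply: (le_trans (le_normcD _ _)); rewrite normcN Pabs.
  by have := Q_le1 n; have /andP[] := P01 n.+1; lra.
- move=> n nN; rewrite nD//; apply: (le_trans (le_normcD _ _)); rewrite normcN Pabs.
  have := Ps1 n; have : nc (Q n) <= 5 * (2 ^+ n * t)^-1; last by lra.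
  apply: decay_sq => //; first exact: nc_ge0.
  have := QD n; rewrite sE; have := sqr_ge0 (nc (Q n)).
  lra.
- move=> m mK; have -> : (10 : R) = 5 + 5 by ring.
  rewrite nS//; apply: min_quadratic => //; rewrite ler_norml.
    have := P1 m; have := P1 m.+1; rewrite [2 ^+ m.+1]exprS exprMn -sE.
    have /andP[] := P01 m; have /andP[] := P01 m.+1.
    have : 0 <= (2 ^+ m) ^+ 2 * X by rewrite mulr_ge0 ?sqr_ge0// ltW.
    lra.
  by have /andP[] := P01 m; have /andP[] := P01 m.+1; lra.
- move=> m mK m0; rewrite nS// ler_norml.
  have := Ps m m0; have := Ps1 m; have /andP[] := P01 m; have /andP[] := P01 m.+1.
  have : 0 < (2 ^+ m * t)^-1 by rewrite invr_gt0.
  lra.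
Qed.
End WithRoot.

(** By Parseval's identity, [multiplier_sum] at each frequency. *)
Lemma l2_bound N f : (N <= K)%N ->
  \sum_x \sum_(n < N) \sum_(m < K) (3 / 2) ^+ gap n m * conv (kD n) (conv (kS m) f) x ^+ 2
    <= 320 * 100 * \sum_x f x ^+ 2.
Proof.
move=> NK.
have [w wP] : exists w : C, L.-primitive_root w.
  case: K LK => [|k]; first by move=> e; exfalso; move: e; rewrite expn0.
  by move=> ->; exact: prim_root_pow2.
have G0 : 0 < #|G|%:R :> R by rewrite ltr0n; apply/card_gt0P; exists 0.
rewrite exchange_big/=; under eq_bigr => n _ do rewrite exchange_big/=.
under eq_bigr => n _ do under eq_bigr => m _ do rewrite -mulr_sumr (conv2_l2 wP) mulrCA.
under eq_bigr => n _ do rewrite -mulr_sumr.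
rewrite -mulr_sumr ler_pdivrMl// mulrCA -(parseval wP).
under eq_bigr => n _ do under eq_bigr => m _ do rewrite mulr_sumr.
under eq_bigr => n _ do rewrite exchange_big/=.
rewrite exchange_big/= mulr_sumr; apply: ler_sum => xi _.
under eq_bigr => n _ do under eq_bigr => m _ do rewrite mulrA.
under eq_bigr => n _ do rewrite -mulr_suml.
by rewrite -mulr_suml ler_wpM2r ?sqr_ge0// multiplier_sum.
Qed.

End L2.

(** * Weighted inequalities and restricted interpolation *)

Section WeightedInequalities.
Context {R : realType}.

(** Expand the nonnegative sum of a (g - c u)^2 / u at the minimising c. *)
Lemma cs_weight (I : finType) (a g u : I -> R) :
  (forall i, 0 <= a i) -> (forall i, 0 < u i) ->
  (\sum_i a i * g i) ^+ 2 <= (\sum_i a i * (g i ^+ 2 / u i)) * (\sum_i a i * u i).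
Proof.
move=> a0 u0; set S := \sum_i _; set A := \sum_i _; set B := \sum_i _.
have B0 : 0 <= B by rewrite sumr_ge0// => i _; rewrite mulr_ge0// ltW.
move: B0; rewrite le_eqVlt => /orP[/eqP B0|B0].
  have z i : a i = 0.
    have : B == 0 by rewrite -B0.
    rewrite psumr_eq0 => [/allP/(_ i (mem_index_enum _))/=|j _]; last by rewrite mulr_ge0// ltW.
    by rewrite mulf_eq0 (gt_eqF (u0 i)) orbF => /eqP.
  by rewrite -B0 mulr0 /S big1 ?expr0n// => i _; rewrite z mul0r.
have : 0 <= \sum_i a i * ((g i - (S / B) * u i) ^+ 2 / u i).
  by rewrite sumr_ge0// => i _; rewrite mulr_ge0// divr_ge0 ?sqr_ge0// ltW.
have -> : \sum_i a i * ((g i - (S / B) * u i) ^+ 2 / u i) =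
    A - 2 * (S / B) * S + (S / B) ^+ 2 * B.
  rewrite {2}/S /B !mulr_sumr /A -sumrB -big_split/=; apply: eq_bigr => i _.
  by rewrite /S /B; field; rewrite !gt_eqF.
have -> : A - 2 * (S / B) * S + (S / B) ^+ 2 * B = A - S ^+ 2 / B.
  by field; rewrite gt_eqF.
by rewrite subr_ge0 ler_pdivrMr.
Qed.

(** After division by the mean m this is the sum of Young's inequalities for the
products (a_i / m) * 1. *)
Lemma jensen_mean (I : finType) (a : I -> R) (r : R) : 1 < r -> (0 < #|I|)%N ->
  (forall i, 0 <= a i) ->
  (#|I|%:R^-1 * \sum_i a i) `^ r <= #|I|%:R^-1 * \sum_i a i `^ r.
Proof.
move=> r1 I0 a0; set n : R := #|I|%:R; have n0 : 0 < n by rewrite ltr0n.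
set m := n^-1 * _.
have m0 : 0 <= m by rewrite mulr_ge0 ?invr_ge0 ?sumr_ge0// ltW.
have rp : 0 < r by lra.
move: m0; rewrite le_eqVlt => /orP[/eqP <-|m0].
  rewrite powR0 ?gt_eqF// mulr_ge0 ?invr_ge0 ?sumr_ge0// ?ltW// => i _.
  exact: powR_ge0.
have mr0 : 0 < m `^ r by exact: powR_gt0.
have q0 : 0 < 1 - r^-1 by rewrite subr_gt0 invf_lt1.
(* Young's inequality for a i / m and 1 *)
have young i : a i / m <= (a i `^ r / m `^ r) / r + (1 - r^-1).
  have := @conjugate_powR R (a i / m) 1 r (1 - r^-1)^-1.
  rewrite mulr1 invrK powR1 mul1r powRM ?invr_ge0 ?(ltW m0)// powRV ?(ltW m0)//.
  apply=> //; last by ring.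
  - by rewrite divr_ge0// ltW.
  - by rewrite invr_gt0.
have sumE : \sum_i a i = n * m by rewrite /m mulVKf// gt_eqF.
have : \sum_i a i / m <= \sum_i ((a i `^ r / m `^ r) / r + (1 - r^-1)).
  by apply: ler_sum => i _.
rewrite -mulr_suml sumE mulfK ?gt_eqF// big_split/= sumr_const -!mulr_suml.
set T := \sum_i a i `^ r; rewrite -[X in _ + X]mulr_natl -/n => H.
rewrite -(ler_pM2l n0) mulVKf ?gt_eqF//.
have : n / r <= T / m `^ r / r by move: H; rewrite mulrBr mulr1; lra.
by rewrite ler_pM2r ?invr_gt0// ler_pdivlMr.
Qed.

End WeightedInequalities.

Section Interpolation.
Context {R : realType}.

Definition indic (T : finType) (E : {set T}) (x : T) : R := (x \in E)%:R.

Lemma sum_indic (T : finType) (E : {set T}) : \sum_x indic E x = #|E|%:R.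
Proof.
by rewrite -sum1_card natr_sum [RHS]big_mkcond; apply: eq_bigr => x _; rewrite /indic; case: ifP.
Qed.

Lemma indic01 (T : finType) (E : {set T}) x : 0 <= indic E x <= 1.
Proof. by rewrite /indic; case: (_ \in _); rewrite /= ?lexx ?ler01. Qed.

(** The properties of a maximal operator over averages that real interpolation
uses; sums on the right are finite because every function on a finite set meets
finitely many dyadic levels. *)
Definition sublinear (T : finType) (A : (T -> R) -> T -> R) : Prop :=
  [/\ forall h x, 0 <= A h x,
      forall h c, (forall x, 0 <= h x <= c) -> forall x, A h x <= c &
      forall (h : T -> R) (I : nat) (c : 'I_I -> R) (g : 'I_I -> T -> R),
        (forall i, 0 <= c i) -> (forall i x, 0 <= g i x) ->
        (forall x, 0 <= h x <= \sum_i c i * g i x) ->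
        forall x, A h x <= \sum_i c i * A (g i) x].

(** Restricted strong type at q gives strong type at every p > q: decompose f into
its dyadic level sets E_j, so that A f is at most the sum of the 2^-j A 1_(E_j),
whose terms lie in [0, 2^-j], and apply [interp_pointwise] at each point. *)
Lemma interpolation (q p : R) : 0 < q -> q < p -> exists C : R, 0 < C /\
  forall (T : finType) (A : (T -> R) -> T -> R) (B : R), sublinear A ->
  (forall E : {set T}, \sum_x A (indic E) x `^ q <= B * #|E|%:R) ->
  forall f : T -> R, (forall x, 0 <= f x <= 1) ->
  \sum_x A f x `^ p <= C * B * \sum_x f x `^ p.
Proof.
move=> q0 qp; have p0 : 0 < p := lt_trans q0 qp.
have [C [C0 HC]] := interp_pointwise q0 qp.
exists (C * 2 `^ p); split; first by rewrite mulr_gt0// powR_gt0.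
move=> T A B [Age Ale Asub] AB f f01.
have f0 x : 0 <= f x by have /andP[] := f01 x.
have f1 x : f x <= 1 by have /andP[] := f01 x.
have [i [I iP]] := bracket_unif f1.
pose E (j : nat) : {set T} := [set x | (0 < f x) && (i x == j)]%SET.
pose h (j : nat) : R := 2^-1 ^+ j.
have h0 j : 0 < h j by rewrite exprn_gt0// invr_gt0.
have fle x : f x <= \sum_(j < I) h j * indic (E j) x.
  have t0 (j : 'I_I) : 0 <= h j * indic (E j) x.
    by apply: mulr_ge0; [exact: ltW|have /andP[] := indic01 (E j) x].
  have [fx|fx] := ltP 0 (f x); last by apply: (le_trans fx); rewrite sumr_ge0.
  have [iI /(_ fx)/andP[_ h2]] := iP x.
  rewrite (bigD1 (Ordinal iI))//= ler_wpDr ?sumr_ge0//.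
  by rewrite {1}/indic inE fx eqxx mulr1.
have Afle x : A f x <= \sum_(j < I) h j * A (indic (E j)) x.
  apply: (Asub f I (fun j : 'I_I => h j) (fun j : 'I_I => indic (E j))) => [j|j y|y].
  - exact: ltW.
  - by have /andP[] := indic01 (E j) y.
  - by rewrite f0 fle.
have g01 (j : 'I_I) x : 0 <= A (indic (E j)) x <= 1.
  by rewrite Age/=; apply: Ale => y; exact: indic01.
have step x : A f x `^ p <= C * \sum_(j < I) h j `^ p * A (indic (E j)) x `^ q.
  apply: le_trans (HC I (fun j => A (indic (E j)) x) (fun j => g01 j x)).
  by apply: ler_powR2l; [exact: ltW|exact: Age|exact: Afle].
apply: (le_trans (ler_sum _ (fun x _ => step x))).
rewrite -mulr_sumr exchange_big/= -!mulrA ler_wpM2l ?(ltW C0)//.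
have B0 (x : T) : 0 <= B.
  have := AB [set x]%SET; rewrite cards1 mulr1; apply: le_trans.
  by rewrite sumr_ge0// => y _; exact: powR_ge0.
apply: (@le_trans _ _ (\sum_(j < I) \sum_(x in E j) B * (2 * f x) `^ p)).
  apply: ler_sum => j _; rewrite -[leLHS]mulr_sumr.
  apply: (le_trans (ler_wpM2l (powR_ge0 _ _) (AB (E j)))).
  rewrite mulrCA -[leRHS]mulr_sumr.
  have [->|[x0 _]] := set_0Vmem (E j).
    by rewrite cards0 mulr0 mulr0 big_set0 mulr0.
  rewrite ler_wpM2l ?(B0 x0)// mulr_natr -sumr_const; apply: ler_sum => x.
  rewrite inE => /andP[fx /eqP ix]; apply: ler_powR2l; [exact: ltW|exact: ltW|].
  have [_ /(_ fx)/andP[h1 _]] := iP x.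
  by move: h1; rewrite ix exprS -/(h j); move: (h j) (f x); clear => a b; lra.
rewrite (eq_bigr (fun j : 'I_I => \sum_x if x \in E j then B * (2 * f x) `^ p else 0)); last first.
  by move=> j _; rewrite [LHS]big_mkcond.
rewrite exchange_big/= !mulr_sumr; apply: ler_sum => x _.
have [fx|fx] := ltP 0 (f x); last first.
  rewrite big1 ?mulr_ge0 ?powR_ge0 ?(B0 x)// => j _.
  by rewrite inE ltNge fx.
have [iI _] := iP x.
rewrite (bigD1 (Ordinal iI))//= inE fx eqxx/= big1 ?addr0 => [|j jx]; last first.
  by rewrite inE fx/=; case: eqP => // e; case/eqP: jx; apply/val_inj.
by rewrite powRM// mulrCA.
Qed.

End Interpolation.

Section PointwiseHolder.
Context {R : realType}.

Lemma weighted_product_le (a b c x y z : R) :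
  0 <= a -> 0 <= b -> 0 <= c -> a + b + c = 1 -> 0 <= x -> 0 <= y -> 0 <= z ->
  x `^ a * y `^ b * z `^ c <= x + y + z.
Proof.
move=> a0 b0 c0 abc x0 y0 z0; set S := x + y + z.
have S0 : 0 <= S by rewrite /S !addr_ge0.
have -> : S = S `^ a * S `^ b * S `^ c.
  move: S0; rewrite le_eqVlt => /orP[/eqP <-|S0]; last first.
    by rewrite -!powR_add// abc powRr1// ltW.
  have [a1|a1] := eqVneq a 0; last by rewrite (powR0 a1) !mul0r.
  have [b1|b1] := eqVneq b 0; last by rewrite (powR0 b1) mulr0 mul0r.
  have c1 : c = 1 by move: abc; rewrite a1 b1 !add0r.
  by rewrite c1 powRr1// mulr0.
rewrite ler_pM ?mulr_ge0 ?powR_ge0//; last by apply: ler_powR2l => //; rewrite /S; lra.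
by rewrite ler_pM ?powR_ge0//; apply: ler_powR2l => //; rewrite /S; lra.
Qed.

(** Here h n m stands for |D_n S_m 1_E| at a point.  Every h n m is bounded through
each of the first two sums separately, with the factors (3/2)^-g and k^-g for the
gap g = |n - m|.  A geometric mean of the two bounds with exponents 1 - sg and sg
has the factor ((3/2)^(1 - sg) k^sg)^-g; the value of k makes it summable in m.
The remaining power of the second sum is traded for v, and the exponent of v is
chosen so that the three powers add up to 1. *)
Lemma pointwise_holder (q : R) : 1 < q -> q < 2 ->
  exists k C : R, [/\ 0 < k < 1, 0 < C &
  forall (N K : nat) (h : nat -> nat -> R) (v B : R),
  (forall n m, 0 <= h n m) -> 0 < v -> 0 < B ->
  forall n : 'I_N, (\sum_(m < K) h n m) `^ q <= C * B `^ (1 - q / 2) *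
   (\sum_(n < N) \sum_(m < K) (3 / 2) ^+ gap n m * h n m ^+ 2
   + (\sum_(n < N) \sum_(m < K) k ^+ gap n m * h n m ^+ 2) / v
   + v `^ ((3 - q) / 2 * q / (2 - q)) / B)].
Proof.
move=> q1 q2; pose sg := (3 - q) / 2; pose r := (3 - q) / 2 * q / (2 - q).
have sg0 : 0 < sg by rewrite /sg; lra.
have sg1 : 0 < 1 - sg by rewrite /sg; lra.
have b0 : 0 < (3 / 2 : R) by lra.
(* With this k one has (3/2)^(1 - sg) k^sg = (3/2)^((1 - sg) / 2) > 1. *)
pose k := (3 / 2 : R) `^ (- ((1 - sg) / (2 * sg))).
pose th := (3 / 2 : R) `^ (- ((1 - sg) / 4)).
have e1 : 0 < (1 - sg) / (2 * sg) by rewrite divr_gt0// mulr_gt0.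
have e2 : 0 < (1 - sg) / 4 by rewrite divr_gt0.
have lt1 (e : R) : 0 < e -> 0 < (3 / 2 : R) `^ (- e) < 1.
  move=> e0; rewrite powR_gt0//= powRN invf_lt1 ?powR_gt0//.
  by apply: powR_gt1 => //; lra.
have /andP[th0 th1] := lt1 _ e2.
have t1 : 0 < 1 - th by rewrite subr_gt0.
exists k, ((2 / (1 - th)) `^ q); split; [exact: lt1|by rewrite powR_gt0 ?divr_gt0|].
move=> N K h v B h0 v0 B0 n.
set H1 := \sum_(n < N) _; set H2 := \sum_(n < N) _.
have k0 : 0 < k by have /andP[] := lt1 _ e1.
have t0 (c : R) (n0 : 'I_N) (m : 'I_K) : 0 < c -> 0 <= c ^+ gap n0 m * h n0 m ^+ 2.
  by move=> c0; rewrite mulr_ge0 ?sqr_ge0// exprn_ge0// ltW.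
have Hge (c : R) (m : 'I_K) : 0 < c -> c ^+ gap n m * h n m ^+ 2 <=
    \sum_(n < N) \sum_(m < K) c ^+ gap n m * h n m ^+ 2.
  move=> c0; rewrite (bigD1 n)//= (bigD1 m)//= -addrA lerDl addr_ge0//.
    by rewrite sumr_ge0// => m' _; exact: t0.
  by rewrite sumr_ge0// => n' _; rewrite sumr_ge0// => m' _; exact: t0.
have H10 : 0 <= H1 by rewrite sumr_ge0// => n' _; rewrite sumr_ge0// => m' _; exact: t0.
have H20 : 0 <= H2 by rewrite sumr_ge0// => n' _; rewrite sumr_ge0// => m' _; exact: t0.
pose W := H1 `^ ((1 - sg) / 2) * H2 `^ (sg / 2).
have W0 : 0 <= W by rewrite mulr_ge0 ?powR_ge0.
have hW (m : 'I_K) : h n m <= W * th ^+ gap n m.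
  set g := gap n m.
  have hE (c : R) : h n m `^ c = (h n m ^+ 2) `^ (c / 2).
    by rewrite -powR_mulrn// -powRrM; congr (_ `^ _); field.
  have -> : h n m = (h n m ^+ 2) `^ ((1 - sg) / 2) * (h n m ^+ 2) `^ (sg / 2).
    rewrite -!hE; have := h0 n m; rewrite le_eqVlt => /orP[/eqP <-|hp].
      by rewrite powR0 ?mul0r// gt_eqF.
    by rewrite -powR_add// subrK powRr1// ltW.
  have A1 : h n m ^+ 2 <= H1 / (3 / 2) ^+ g.
    by rewrite ler_pdivlMr ?exprn_gt0// mulrC; exact: Hge.
  have A2 : h n m ^+ 2 <= H2 / k ^+ g.
    by rewrite ler_pdivlMr ?exprn_gt0// mulrC; exact: Hge.
  have E : th ^+ g = ((3 / 2) ^+ g)^-1 `^ ((1 - sg) / 2) * ((k ^+ g)^-1) `^ (sg / 2).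
    rewrite !powRV ?exprn_ge0 ?(ltW k0)// ?(ltW b0)// !powR_exprn ?(ltW k0)// ?(ltW b0)//.
    rewrite -!exprVn -exprMn -!powRN /k -powRrM -powR_add//; congr (_ ^+ _).
    by rewrite /th; congr (_ `^ _); field; rewrite gt_eqF.
  rewrite /W E mulrACA -!powRM// ?invr_ge0 ?exprn_ge0 ?(ltW k0)// ?(ltW b0)//.
  rewrite ler_pM ?powR_ge0//; apply: ler_powR2l => //; rewrite ?sqr_ge0//.
  - by rewrite divr_ge0// ltW.
  - by rewrite divr_ge0// ltW.
have sumW : \sum_(m < K) h n m <= 2 / (1 - th) * W.
  apply: (le_trans (ler_sum _ (fun m _ => hW m))); rewrite -mulr_sumr mulrC.
  by rewrite ler_wpM2r// sum_gap_le// ltW.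
have S0 : 0 <= \sum_(m < K) h n m by rewrite sumr_ge0.
have q0 : 0 <= q by lra.
apply: (le_trans (ler_powR2l q0 S0 sumW)).
rewrite powRM// ?divr_ge0 ?(ltW t1)// -mulrA ler_wpM2l ?powR_ge0//.
have -> : W `^ q = H1 `^ ((1 - sg) * q / 2) * H2 `^ (sg * q / 2).
  by rewrite /W powRM ?powR_ge0// -!powRrM; congr (_ `^ _ * _ `^ _); field.
have -> : H2 `^ (sg * q / 2) = B `^ (1 - q / 2) * ((H2 / v) `^ (sg * q / 2) * (v `^ r / B) `^ (1 - q / 2)).
  rewrite (powRM _ (powR_ge0 _ _)) ?invr_ge0 ?(ltW B0)// powRV ?(ltW B0)//.
  rewrite -powRrM.
  have -> : r * (1 - q / 2) = sg * q / 2.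
    by rewrite /r /sg; field; rewrite gt_eqF//; lra.
  rewrite (powRM _ H20) ?invr_ge0 ?(ltW v0)// powRV ?(ltW v0)//.
  by field; rewrite !gt_eqF// powR_gt0.
rewrite mulrCA ler_wpM2l ?powR_ge0// mulrA.
apply: weighted_product_le => //.
- by rewrite divr_ge0// mulr_ge0// ltW.
- by rewrite divr_ge0// mulr_ge0// ltW.
- by lra.
- by rewrite /sg; field.
- by rewrite divr_ge0// ltW.
- by rewrite divr_ge0 ?powR_ge0// ltW.
Qed.

End PointwiseHolder.

(** * The maximal operator on the torus *)

Section Markov.
Context {R : realType} {d l : nat}.
Local Notation G := (torus d l).
Implicit Types (f g h u k : G -> R) (x t : G).

Definition markov k : Prop := (forall t, 0 <= k t) /\ \sum_t k t = 1.

Lemma torus_gt0 : 0 < #|G|%:R :> R.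
Proof. by rewrite ltr0n; apply/card_gt0P; exists 0. Qed.

Lemma conv_le k g h : markov k -> (forall x, g x <= h x) -> forall x, conv k g x <= conv k h x.
Proof. by move=> [k0 _] gh x; apply: ler_sum => t _; rewrite ler_wpM2l. Qed.

Lemma conv_cst k (c : R) x : markov k -> conv k (fun=> c) x = c.
Proof. by move=> [_ k1]; rewrite /conv -mulr_suml k1 mul1r. Qed.

Lemma conv_ge0 k h : markov k -> (forall x, 0 <= h x) -> forall x, 0 <= conv k h x.
Proof. by move=> kP h0 x; rewrite -[leLHS](conv_cst 0 x kP) conv_le. Qed.

Lemma conv_gt0 k h : markov k -> (forall x, 0 < h x) -> forall x, 0 < conv k h x.
Proof.
move=> [k0 k1] h0 x; rewrite lt_def sumr_ge0 ?andbT; last by move=> t _; rewrite mulr_ge0// ltW.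
apply/eqP => /eqP; rewrite psumr_eq0; last by move=> t _; rewrite mulr_ge0// ltW.
move=> /allP H; suff : \sum_t k t = 0 by rewrite k1 => /eqP; rewrite oner_eq0.
rewrite big1// => t _; have := H t (mem_index_enum _).
by rewrite /= mulf_eq0 (gt_eqF (h0 _)) orbF => /eqP.
Qed.

Lemma conv_sum k h : markov k -> \sum_x conv k h x = \sum_x h x.
Proof.
move=> [_ k1]; rewrite /conv exchange_big/=.
rewrite (eq_bigr (fun t => k t * \sum_x h x)) -?mulr_suml ?k1 ?mul1r// => t _.
by rewrite -mulr_sumr [in RHS](reindex_inj (addIr (- t))).
Qed.

Lemma conv_cs k g u x : markov k -> (forall x, 0 < u x) ->
  conv k g x ^+ 2 <= conv k (fun y => g y ^+ 2 / u y) x * conv k u x.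
Proof. by move=> [k0 _] u0; apply: (@cs_weight R G k (fun t => g (x - t)) (fun t => u (x - t))). Qed.

Lemma convBl k g h x : conv (fun t => k t - g t) h x = conv k h x - conv g h x.
Proof. by rewrite /conv -sumrB; apply: eq_bigr => t _; rewrite mulrBl. Qed.

Lemma convDr k g h x : conv k (fun y => g y + h y) x = conv k g x + conv k h x.
Proof. by rewrite /conv -big_split; apply: eq_bigr => t _; rewrite /= mulrDr. Qed.

Lemma conv_sumr k (I : nat) (c : 'I_I -> R) (g : 'I_I -> G -> R) x :
  conv k (fun y => \sum_i c i * g i y) x = \sum_i c i * conv k (g i) x.
Proof.
rewrite /conv; under eq_bigr do rewrite mulr_sumr.
rewrite exchange_big/=; apply: eq_bigr => i _; rewrite mulr_sumr.
by apply: eq_bigr => t _; rewrite mulrCA.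
Qed.

Lemma eq_conv k g h : g =1 h -> conv k g =1 conv k h.
Proof. by move=> gh x; apply: eq_bigr => t _; rewrite gh. Qed.

Lemma kM_markov n : markov (@kM R d l n).
Proof.
have c0 : #|{ffun 'I_d -> 'I_(2 * 2 ^ n).+1}|%:R != 0 :> R.
  by rewrite pnatr_eq0 card_ffun !card_ord -lt0n expn_gt0.
split=> [t|]; first by rewrite /kM /kpush mulr_ge0 ?invr_ge0// sumr_ge0.
rewrite /kM /kpush -mulr_sumr exchange_big/=.
rewrite (eq_bigr (fun=> 1)) ?sumr_const ?mulVf// => i _.
by rewrite (bigD1 (cube_pt l i))//= eqxx big1 ?addr0// => t; rewrite eq_sym => /negbTE ->.
Qed.

Lemma kF_markov K (k : nat) : l.+2 = (2 ^ K)%N -> (k <= K)%N -> markov (@kF R d l k).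
Proof.
move=> LK kK; split=> [t|].
  by rewrite /kF mulr_ge0 ?sumr_ge0// invr_ge0 mulr_ge0// exprn_ge0.
have := @conv_kF R d l K LK k (fun=> 1) 0 kK.
rewrite {1}/conv -mulr_suml mulr1 => ->.
under eq_bigr do rewrite cnd1.
by rewrite sumr_const mulVf// gt_eqF// torus_gt0.
Qed.

(** The F_k are included because the bootstrap needs a weight that dominates the
images of u under both operators that make up D_n. *)
Definition Astar N h x : R :=
  \big[Num.max/0]_(n < N) Num.max (conv (@kM R d l n) h x) (conv (@kF R d l n.+1) h x).

Lemma Astar_kM N n h x : (n < N)%N -> conv (@kM R d l n) h x <= Astar N h x.
Proof. by move=> nN; rewrite /Astar (bigD1 (Ordinal nN))//= !le_max lexx. Qed.

Lemma Astar_kF N n h x : (n < N)%N -> conv (@kF R d l n.+1) h x <= Astar N h x.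
Proof. by move=> nN; rewrite /Astar (bigD1 (Ordinal nN))//= !le_max lexx orbT. Qed.

Lemma Astar_le N h x (c : R) : 0 <= c ->
  (forall n, (n < N)%N -> conv (@kM R d l n) h x <= c) ->
  (forall n, (n < N)%N -> conv (@kF R d l n.+1) h x <= c) -> Astar N h x <= c.
Proof.
move=> c0 cM cF; rewrite /Astar; elim/big_ind : _ => // [a b ac bc|n _].
  by rewrite ge_max ac.
by rewrite ge_max cM// cF.
Qed.

Lemma Astar_sublinear K N : l.+2 = (2 ^ K)%N -> (N <= K)%N -> sublinear (Astar N).
Proof.
move=> LK NK.
have Fm n : (n < N)%N -> markov (@kF R d l n.+1).
  by move=> nN; apply: kF_markov LK _; exact: leq_trans NK.
have A0 h x : 0 <= Astar N h x by exact: bigmax_ge_id.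
have Ac h (c : R) : (forall x, 0 <= h x <= c) -> forall x, Astar N h x <= c.
  move=> hc x; apply: Astar_le.
  - by have /andP[h0 /(le_trans h0)] := hc x.
  - move=> n nN; rewrite -[leRHS](conv_cst c x (kM_markov n)).
    by apply: conv_le (kM_markov n) _ _ => y; have /andP[] := hc y.
  - move=> n nN; rewrite -[leRHS](conv_cst c x (Fm n nN)).
    by apply: conv_le (Fm n nN) _ _ => y; have /andP[] := hc y.
split=> // h I c g c0 g0 hc x.
apply: Astar_le; first by rewrite sumr_ge0// => i _; rewrite mulr_ge0.
- move=> n nN; apply: (@le_trans _ _ (conv (kM n) (fun y => \sum_i c i * g i y) x)).
    by apply: conv_le (kM_markov n) _ _ => y; have /andP[] := hc y.
  by rewrite conv_sumr; apply: ler_sum => i _; rewrite ler_wpM2l// Astar_kM.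
- move=> n nN; apply: (@le_trans _ _ (conv (kF n.+1) (fun y => \sum_i c i * g i y) x)).
    by apply: conv_le (Fm n nN) _ _ => y; have /andP[] := hc y.
  by rewrite conv_sumr; apply: ler_sum => i _; rewrite ler_wpM2l// Astar_kF.
Qed.

End Markov.

(** * Domination by shifted dyadic martingales *)

Section Grids.
Context {R : realType} {d l K : nat}.
Hypothesis LK : l.+2 = (2 ^ K)%N.
Local Notation G := (torus d l).
Local Notation n1 := (#|G|%:R^-1 : R).
Local Notation blk := (@blk d l).
Variable E : {set G}.
Local Notation f := (@indic R G E).

(** Translating the grid by om amounts to translating the set E: one fixed
filtration serves all grids, and the value at x in the grid om is read at
x + om. *)
Definition shifted (om y : G) : R := f (y - om).
Definition gridmax (om y : G) : R := mmax blk K (shifted om) y.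
Definition gridmean (H : G -> G -> R) (x : G) : R := n1 * \sum_(om : G) H om (x + om).

Lemma shifted01 om y : 0 <= shifted om y <= 1.
Proof. exact: indic01. Qed.

Lemma sum_shifted om : \sum_y shifted om y = #|E|%:R.
Proof. by rewrite -(sum_indic (R := R)) [RHS](reindex_inj (addIr (- om))). Qed.

Lemma gridmax_le1 om y : gridmax om y <= 1.
Proof. by apply: mmax_le1 => z; have /andP[] := shifted01 om z. Qed.

Lemma sum_gridmean (H : G -> G -> R) :
  \sum_x gridmean H x = n1 * \sum_(om : G) \sum_y H om y.
Proof.
rewrite /gridmean -mulr_sumr exchange_big/=; congr (_ * _); apply: eq_bigr => om _.
by rewrite [RHS](reindex_inj (addIr om)).
Qed.

Lemma sum_gridmean_le (H : G -> G -> R) (c : R) : (forall om, \sum_y H om y <= c) ->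
  \sum_x gridmean H x <= c.
Proof.
move=> Hc; rewrite sum_gridmean ler_pdivrMl ?torus_gt0// mulr_natl -sumr_const.
by apply: ler_sum => om _.
Qed.

Lemma gridmean_le (H H' : G -> G -> R) : (forall om y, H om y <= H' om y) ->
  forall x, gridmean H x <= gridmean H' x.
Proof.
move=> HH x; rewrite ler_wpM2l ?invr_ge0 ?ler0n//.
by apply: ler_sum => om _.
Qed.

Lemma gridmean_ge0 (H : G -> G -> R) : (forall om y, 0 <= H om y) ->
  forall x, 0 <= gridmean H x.
Proof. by move=> H0 x; rewrite mulr_ge0 ?invr_ge0 ?ler0n ?sumr_ge0. Qed.

Lemma kF_gridmean k x : (k <= K)%N ->
  conv (@kF R d l k) f x = gridmean (fun om => cnd blk k (shifted om)) x.
Proof. exact: conv_kF. Qed.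

Lemma kF_le_gridmax k x : (k <= K)%N -> conv (@kF R d l k) f x <= gridmean gridmax x.
Proof.
move=> kK; rewrite kF_gridmean//; apply: gridmean_le => om y.
exact: cnd_le_mmax.
Qed.

Lemma blk_top (x y : G) : blk K x = blk K y.
Proof.
apply/ffunP => j; rewrite !ffunE !divn_small//.
- by rewrite -LK.
- by rewrite -LK.
Qed.

Lemma gridmax_gt0 om y : (0 < #|E|)%N -> 0 < gridmax om y.
Proof.
move=> E0; apply: (@lt_le_trans _ _ (cnd blk K (shifted om) y)); last exact: cnd_le_mmax.
rewrite divr_gt0 ?block_card_gt0//.
rewrite (eq_bigl xpredT) ?sum_shifted ?ltr0n// => z.
by apply/eqP; exact: blk_top.
Qed.

Lemma kF0 x : conv (@kF R d l 0) f x = f x.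
Proof.
rewrite kF_gridmean// /gridmean.
have e om : cnd blk 0 (shifted om) (x + om) = f x.
  have inj y z : blk 0 y = blk 0 z -> y = z :> G.
    by move=> /ffunP h; apply/ffunP => j; have := h j; rewrite !ffunE expn0 !divn1 => /val_inj.
  rewrite /cnd (eq_bigl (pred1 (x + om))) => [|y]; last by apply/eqP/eqP => [/inj|->].
  rewrite big_pred1_eq (eq_card (B := pred1 (x + om))) => [|y].
    by rewrite card1 divr1 /shifted addrK.
  by rewrite !inE; apply/eqP/eqP => [/inj|->].
under eq_bigr do rewrite e.
by rewrite sumr_const -[f x *+ _]mulr_natl mulKf// gt_eqF// torus_gt0.
Qed.

Lemma kF_top x : conv (@kF R d l K) f x = conv (@kF R d l K) f 0.
Proof.
rewrite !kF_gridmean// /gridmean; congr (_ * _); apply: eq_bigr => om _.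
by apply: cnd_eq; exact: blk_top.
Qed.

Lemma f_telescope x : f x = \sum_(m < K) conv (@kS R d l m) f x + conv (@kF R d l K) f x.
Proof.
rewrite (eq_bigr (fun m : 'I_K => - (conv (@kF R d l m.+1) f x - conv (@kF R d l m) f x))).
  rewrite sumrN -(big_mkord xpredT (fun m => conv (@kF R d l m.+1) f x - conv (@kF R d l m) f x)).
  by rewrite telescope_sumr// kF0 opprB subrK.
by move=> m _; rewrite convBl opprB.
Qed.

(** The telescoping sum of the S_m recovers 1_E up to its mean value, a constant
that D_n annihilates. *)
Lemma kD_decomp n x : (n < K)%N -> conv (@kD R d l n) f x =
  \sum_(m < K) conv (@kD R d l n) (conv (@kS R d l m) f) x.
Proof.
move=> nK.
have e : f =1 (fun y => \sum_(m < K) 1 * conv (@kS R d l m) f y + conv (@kF R d l K) f 0).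
  by move=> y; rewrite -(kF_top y) {1}f_telescope; congr (_ + _); apply: eq_bigr => m _; rewrite mul1r.
rewrite (eq_conv _ e) convDr [X in _ + X]convBl (conv_cst _ _ (kM_markov n)) (conv_cst _ _ (kF_markov LK nK)).
by rewrite subrr addr0 conv_sumr; apply: eq_bigr => m _; rewrite mul1r.
Qed.

Section Weight.
Variable b : R.
Hypothesis b0 : 0 < b.
Hypothesis E0 : (0 < #|E|)%N.

(** The mean over the grids enters through the Cauchy-Schwarz inequality in
[kS_energy], which is why the power b is taken before the mean. *)
Definition weight (x : G) : R := gridmean (fun om y => gridmax om y `^ b) x.

Lemma weight_gt0 x : 0 < weight x.
Proof.
rewrite /weight /gridmean mulr_gt0 ?invr_gt0 ?torus_gt0//.
rewrite (bigD1 0)//= ltr_pwDl ?powR_gt0 ?gridmax_gt0//.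
by rewrite sumr_ge0// => om _; exact: powR_ge0.
Qed.

Lemma weight01 x : 0 <= weight x <= 1.
Proof.
rewrite ltW ?weight_gt0//= /weight /gridmean.
rewrite ler_pdivrMl ?torus_gt0// mulr1 -sum1_card natr_sum; apply: ler_sum => om _.
by apply: powR_le1; [exact: ltW|rewrite gridmax_le1 ltW// gridmax_gt0].
Qed.

Lemma kS_energy m x : (m < K)%N -> conv (@kS R d l m) f x ^+ 2 / weight x <=
  gridmean (fun om y => (cnd blk m (shifted om) y - cnd blk m.+1 (shifted om) y) ^+ 2
                        * gridmax om y `^ (- b)) x.
Proof.
move=> mK; rewrite ler_pdivrMr ?weight_gt0// convBl !kF_gridmean//; last exact: ltnW.
have -> : gridmean (fun om => cnd blk m (shifted om)) x -
   gridmean (fun om => cnd blk m.+1 (shifted om)) x =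
   \sum_(om : G) n1 * (cnd blk m (shifted om) (x + om) - cnd blk m.+1 (shifted om) (x + om)).
  by rewrite /gridmean -mulrBr -sumrB mulr_sumr.
have := @cs_weight R G (fun=> n1)
  (fun om => cnd blk m (shifted om) (x + om) - cnd blk m.+1 (shifted om) (x + om))
  (fun om => gridmax om (x + om) `^ b).
move=> /(_ _ _)/le_trans; apply.
- by move=> _; rewrite invr_ge0.
- by move=> om; rewrite powR_gt0// gridmax_gt0.
rewrite le_eqVlt; apply/orP; left; apply/eqP; rewrite /weight /gridmean.
congr (_ * _); rewrite [RHS]mulr_sumr; apply: eq_bigr => om _ //.
by rewrite powRN.
Qed.
End Weight.
End Grids.

(** * The bootstrap *)

Section Bootstrap.
Context {R : realType}.

Lemma powR_addle (q a c : R) : 0 < q -> 0 <= a -> 0 <= c ->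
  (a + c) `^ q <= 2 `^ q * (a `^ q + c `^ q).
Proof.
move=> q0 a0 c0.
have H (x y : R) : 0 <= x -> x <= y -> (x + y) `^ q <= 2 `^ q * (x `^ q + y `^ q).
  move=> x0 xy; have y0 : 0 <= y := le_trans x0 xy.
  apply: (@le_trans _ _ ((2 * y) `^ q)); first by apply: ler_powR2l; lra.
  by rewrite powRM// ler_wpM2l ?powR_ge0// lerDr powR_ge0.
have [ac|/ltW ca] := leP a c; first exact: H.
by rewrite addrC [X in _ * X]addrC; exact: H.
Qed.

(** Each averaging operator A satisfies (A g)^2 <= A (g^2 / u) A u, and A preserves
sums. *)
Lemma sum_div_weight (d l K : nat) (LK : l.+2 = (2 ^ K)%N) (n : nat) (g u v : torus d l -> R) :
  (n < K)%N -> (forall x, 0 < u x) -> (forall x, 0 < v x) ->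
  (forall x, conv (@kM R d l n) u x <= v x) -> (forall x, conv (@kF R d l n.+1) u x <= v x) ->
  \sum_x conv (@kD R d l n) g x ^+ 2 / v x <= 4 * \sum_x g x ^+ 2 / u x.
Proof.
move=> nK u0 v0 uM uF.
have MM := @kM_markov R d l n; have MF := @kF_markov R d l K n.+1 LK nK.
have cs (k : torus d l -> R) : markov k -> (forall x, conv k u x <= v x) ->
    forall x, conv k g x ^+ 2 / v x <= conv k (fun y => g y ^+ 2 / u y) x.
  move=> kP ku x; rewrite ler_pdivrMr//; apply: (le_trans (conv_cs g x kP u0)).
  rewrite ler_wpM2l//; apply: conv_ge0 => // y.
  by rewrite divr_ge0 ?sqr_ge0// ltW.
rewrite mulr_sumr.
apply: (@le_trans _ _ (\sum_x (2 * conv (@kM R d l n) (fun y => g y ^+ 2 / u y) x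
   + 2 * conv (@kF R d l n.+1) (fun y => g y ^+ 2 / u y) x))); last first.
  by rewrite big_split/= -!mulr_sumr !conv_sum//; lra.
apply: ler_sum => x _; apply: (@le_trans _ _
   (2 * (conv (@kM R d l n) g x ^+ 2 / v x) + 2 * (conv (@kF R d l n.+1) g x ^+ 2 / v x))).
  rewrite !mulrA -mulrDl ler_wpM2r ?invr_ge0 ?(ltW (v0 x))// convBl.
  by move: (conv _ _ _) (conv _ _ _) => a c; have := sqr_ge0 (a + c); lra.
by have := cs _ MM uM x; have := cs _ MF uF x; lra.
Qed.

Lemma sum_weight_powR (b r C : R) : 1 < r ->
  (forall (T : finType) (V : eqType) (pi : nat -> T -> V),
    (forall k x y, pi k x = pi k y -> pi k.+1 x = pi k.+1 y) ->
    forall K (f : T -> R), (forall x, 0 <= f x <= 1) ->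
    \sum_x (mmax pi K f x) `^ (b * r) <= C * \sum_x f x) ->
  forall (d l K : nat) (E : {set torus d l}),
  \sum_x gridmean (fun om y => gridmax (R := R) (K := K) E om y `^ b) x `^ r <= C * #|E|%:R.
Proof.
move=> r1 Cd d l K E.
apply: (@le_trans _ _ (\sum_x gridmean (fun om y => gridmax (R := R) (K := K) E om y `^ (b * r)) x)).
  apply: ler_sum => x _; rewrite /gridmean.
  apply: (le_trans (jensen_mean r1 _ _)).
  - by apply/card_gt0P; exists 0.
  - by move=> om; exact: powR_ge0.
  by under eq_bigr do rewrite -powRrM.
apply: sum_gridmean_le => om; rewrite -(sum_shifted (R := R) E om).
by apply: Cd => [k x y|x]; [exact: blk_refine|exact: shifted01].
Qed.

(** The exponents: v is summed with the power r = (3 - q)/2 * q / (2 - q) of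
[pointwise_holder], which exceeds q, so interpolation applies to v = Astar u; and
b < 1 is so close to 1 that b r > 1, which makes u^r summable by Doob's
inequality. *)
Lemma bootstrap_step (q : R) : 1 < q -> q < 2 -> exists C : R, 1 <= C /\
  forall (d l K : nat) (LK : l.+2 = (2 ^ K)%N) (N : nat) (B : R),
  (N <= K)%N -> 1 <= B ->
  (forall E : {set torus d l}, \sum_x Astar N (indic E) x `^ q <= B * #|E|%:R) ->
  forall E : {set torus d l},
    \sum_x Astar N (indic E) x `^ q <= C * B `^ (1 - q / 2) * #|E|%:R.
Proof.
move=> q1 q2; have q0 : 0 < q by lra.
have [k [C3 [/andP[k0 k1] C30 H3]]] := pointwise_holder q1 q2.
pose r := (3 - q) / 2 * q / (2 - q).
have rq : q < r.
  by rewrite /r ltr_pdivlMr; nra.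
have r1 : 1 < r by lra.
pose b := (1 + r^-1) / 2.
have ri : 0 < r^-1 < 1 by rewrite invr_gt0 invf_lt1; lra.
have b0 : 0 < b by rewrite /b; lra.
have b1 : b < 1 by rewrite /b; lra.
have br1 : 1 < b * r.
  by rewrite /b mulrAC ltr_pdivlMr// mulrDl mulVf ?gt_eqF//; lra.
have [Cd [Cd0 Hd]] := doob_strong br1.
have [Cq [Cq0 Hq]] := doob_strong q1.
have [Ce [Ce0 He]] := energy b0 b1.
have [Ci [Ci0 Hi]] := interpolation q0 rq.
have k10 : 0 < 2 / (1 - k) by rewrite divr_gt0//; lra.
have [c0 [c00 Hl2]] : exists c0 : R, 0 < c0 /\ forall (d l K : nat),
    l.+2 = (2 ^ K)%N -> forall N (f : torus d l -> R), (N <= K)%N ->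
    \sum_x \sum_(n < N) \sum_(m < K) (3 / 2) ^+ gap n m *
       conv (@kD R d l n) (conv (@kS R d l m) f) x ^+ 2 <= c0 * \sum_x f x ^+ 2.
  by exists (320 * 100); split; [apply: mulr_gt0; rewrite ltr0n|exact: l2_bound].
pose A := c0 + 2 / (1 - k) * 4 * Ce + Ci * Cd.
have k40 : 0 < 2 / (1 - k) * 4 by rewrite mulr_gt0.
have A0 : 0 < A by apply: addr_gt0; [apply: addr_gt0 => //; exact: mulr_gt0|exact: mulr_gt0].
have X0 : 0 <= 2 `^ q * (Cq + C3 * A).
  apply: mulr_ge0; first exact: powR_ge0.
  by apply: addr_ge0; [exact: ltW|apply: mulr_ge0; exact: ltW].
exists (1 + 2 `^ q * (Cq + C3 * A)); split; first by rewrite lerDl.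
move=> d l K LK N B NK B1 HB E.
have B0 : 0 < B by lra.
have Bg1 : 1 <= B `^ (1 - q / 2) by apply: powR_ge1 => //; lra.
have As := @Astar_sublinear R d l K N LK NK.
have [Age Ale Asub] := As.
have C'0 : 0 <= (1 + 2 `^ q * (Cq + C3 * A)) * B `^ (1 - q / 2).
  by apply: mulr_ge0; [rewrite addr_ge0|exact: powR_ge0].
case: (posnP #|E|) => [e0|E0].
  move/eqP: e0; rewrite cards_eq0 => /eqP ->; rewrite cards0 mulr0 big1// => x _.
  have h x' : 0 <= @indic R _ (@finset.set0 (torus d l)) x' <= 0.
    by rewrite /indic finset.in_set0 lexx.
  have -> : Astar N (@indic R _ (@finset.set0 (torus d l))) x = 0.
    by apply: le_anti; rewrite Age (Ale _ _ h).
  by rewrite powR0// gt_eqF.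
case: (posnP N) => [N0|N0].
  rewrite big1 => [|x _]; first by apply: mulr_ge0.
  by rewrite N0 /Astar big_ord0 powR0// gt_eqF.
pose f : torus d l -> R := indic E.
pose u : torus d l -> R := weight (K := K) E b.
have u0 x : 0 < u x by exact: weight_gt0.
have u01 x : 0 <= u x <= 1 by exact: weight01.
pose v := Astar N u.
have v0 x : 0 < v x.
  apply: lt_le_trans (Astar_kM u x N0).
  by apply: conv_gt0 => //; exact: kM_markov.
pose F x := gridmean (gridmax (R := R) (K := K) E) x.
pose h x n m := `|conv (@kD R d l n) (conv (@kS R d l m) f) x|.
pose H1 x := \sum_(n < N) \sum_(m < K) (3 / 2) ^+ gap n m * h x n m ^+ 2.
pose H2 x := \sum_(n < N) \sum_(m < K) k ^+ gap n m * h x n m ^+ 2.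
pose T x := C3 * B `^ (1 - q / 2) * (H1 x + H2 x / v x + v x `^ r / B).
have F0 x : 0 <= F x.
  by apply: gridmean_ge0 => om y; exact: mmax_ge0.
have T0 x : 0 <= T x.
  rewrite mulr_ge0 ?mulr_ge0 ?powR_ge0 ?(ltW C30)// !addr_ge0//.
  - rewrite sumr_ge0// => n _; rewrite sumr_ge0// => m _.
    by rewrite mulr_ge0 ?sqr_ge0// exprn_ge0.
  - rewrite divr_ge0 ?(ltW (v0 x))// sumr_ge0// => n _; rewrite sumr_ge0// => m _.
    by rewrite mulr_ge0 ?sqr_ge0// exprn_ge0// ltW.
  - by rewrite divr_ge0 ?powR_ge0// ltW.
have AF x : Astar N f x <= F x + T x `^ q^-1.
  have t0 : 0 <= T x `^ q^-1 by exact: powR_ge0.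
  apply: Astar_le; first by rewrite addr_ge0.
    move=> n nN; have nK : (n < K)%N := leq_trans nN NK.
    have -> : conv (kM n) f x = conv (kF n.+1) f x + conv (@kD R d l n) f x.
      by rewrite [X in _ + X]convBl addrC subrK.
    apply: lerD; first by apply: kF_le_gridmax.
    apply: (le_trans (ler_norm _)).
    have le1 : `|conv (@kD R d l n) f x| <= \sum_(m < K) h x n m.
      by rewrite /f (kD_decomp LK)//; exact: ler_norm_sum.
    have := H3 N K (h x) (v x) B (fun _ _ => normr_ge0 _) (v0 x) B0 (Ordinal nN).
    rewrite -/(H1 x) -/(H2 x) -/r -/(T x) => H.
    have s0 : 0 <= \sum_(m < K) h x n m by apply: sumr_ge0 => m _; exact: normr_ge0.
    apply: (le_trans le1); rewrite -[leLHS](@powRK _ _ q) ?gt_eqF//.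
    by apply: ler_powR2l; [rewrite invr_ge0 ltW|exact: powR_ge0|exact: H].
  move=> n nN; rewrite ler_wpDr//; apply: kF_le_gridmax => //.
  exact: leq_trans NK.
have step x : Astar N f x `^ q <= 2 `^ q * (F x `^ q + T x).
  apply: (le_trans (ler_powR2l (ltW q0) (Age f x) (AF x))).
  apply: (le_trans (powR_addle q0 (F0 x) (powR_ge0 _ _))).
  by rewrite powRVK ?gt_eqF.
have SF : \sum_x F x `^ q <= Cq * #|E|%:R.
  have := @sum_weight_powR 1 q Cq q1; rewrite mul1r => /(_ Hq d l K E).
  rewrite (eq_bigr (fun x => F x `^ q))// => x _; congr (_ `^ _).
  rewrite /F /gridmean; congr (_ * _); apply: eq_bigr => om _.
  by rewrite powRr1// mmax_ge0.
have SH1 : \sum_x H1 x <= c0 * #|E|%:R.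
  have := Hl2 d l K LK N f NK.
  have -> : \sum_x f x ^+ 2 = #|E|%:R.
    rewrite -(sum_indic (R := R)); apply: eq_bigr => x _.
    by rewrite /f /indic; case: (_ \in _); rewrite ?expr1n ?expr0n.
  apply: le_trans; apply: ler_sum => x _; apply: ler_sum => n _; apply: ler_sum => m _.
  by rewrite /h real_normK// num_real.
have SH2 : \sum_x H2 x / v x <= 2 / (1 - k) * 4 * Ce * #|E|%:R.
  pose W m := \sum_x conv (@kS R d l m) f x ^+ 2 / u x.
  have W0 m : 0 <= W m.
    by rewrite sumr_ge0// => x _; rewrite divr_ge0 ?sqr_ge0// ltW.
  have e1 : \sum_x H2 x / v x = \sum_(n < N) \sum_(m < K) k ^+ gap n m *
      \sum_x conv (@kD R d l n) (conv (@kS R d l m) f) x ^+ 2 / v x.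
    rewrite /H2; under eq_bigr => x _ do rewrite mulr_suml.
    rewrite exchange_big/=; apply: eq_bigr => n _.
    under eq_bigr => x _ do rewrite mulr_suml.
    rewrite exchange_big/=; apply: eq_bigr => m _; rewrite mulr_sumr.
    by apply: eq_bigr => x _; rewrite /h real_normK ?num_real// mulrA.
  rewrite e1.
  apply: (@le_trans _ _ (\sum_(n < N) \sum_(m < K) k ^+ gap n m * (4 * W m))).
    apply: ler_sum => n _; apply: ler_sum => m _.
    rewrite ler_wpM2l ?exprn_ge0 ?(ltW k0)//.
    apply: (sum_div_weight LK) => //; first exact: leq_trans NK.
      by move=> x; exact: Astar_kM.
    by move=> x; exact: Astar_kF.
  rewrite exchange_big/=.
  apply: (@le_trans _ _ (\sum_(m < K) 2 / (1 - k) * 4 * W m)).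
    apply: ler_sum => m _; rewrite -mulr_suml -[leRHS]mulrA ler_wpM2r ?mulr_ge0//.
    under eq_bigr => n _ do rewrite /gap addnC.
    by apply: sum_gap_le; rewrite (ltW k0).
  rewrite -mulr_sumr -[leRHS]mulrA ler_wpM2l ?(ltW k40)//.
  apply: (@le_trans _ _ (\sum_(m < K) \sum_x gridmean (fun om y =>
     (cnd (@blk d l) m (shifted E om) y - cnd (@blk d l) m.+1 (shifted E om) y) ^+ 2
        * gridmax (R := R) (K := K) E om y `^ (- b)) x)).
    apply: ler_sum => m _; apply: ler_sum => x _; exact: kS_energy.
  rewrite exchange_big/=.
  pose Q om y := \sum_(m < K) (cnd (@blk d l) m (shifted E om) y - cnd (@blk d l) m.+1 (shifted E om) y) ^+ 2
        * gridmax (R := R) (K := K) E om y `^ (- b).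
  rewrite (eq_bigr (fun x => gridmean Q x)); last first.
    move=> x _; rewrite /gridmean -mulr_sumr; congr (_ * _).
    by rewrite exchange_big.
  apply: sum_gridmean_le => om; rewrite /Q exchange_big/= -(sum_shifted (R := R) E om).
  by apply: He => [j x y|x]; [exact: blk_refine|exact: shifted01].
have SV : \sum_x v x `^ r / B <= Ci * Cd * #|E|%:R.
  rewrite -mulr_suml ler_pdivrMr//.
  apply: (le_trans (Hi _ _ B As HB u u01)).
  have := @sum_weight_powR b r Cd r1 Hd d l K E; rewrite -/(\sum_x u x `^ r).
  have CB : 0 <= Ci * B by rewrite mulr_ge0// ltW.
  by move=> /(ler_wpM2l CB); lra.
have ST : \sum_x T x <= C3 * B `^ (1 - q / 2) * (A * #|E|%:R).
  rewrite -mulr_sumr ler_wpM2l ?mulr_ge0 ?powR_ge0 ?(ltW C30)// !big_split/=.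
  have -> : A * #|E|%:R = c0 * #|E|%:R + 2 / (1 - k) * 4 * Ce * #|E|%:R + Ci * Cd * #|E|%:R.
    by rewrite /A !mulrDl.
  by apply: lerD; [apply: lerD|].
apply: (le_trans (ler_sum _ (fun x _ => step x))).
rewrite -mulr_sumr big_split/=.
have P0 : 0 <= 2 `^ q :> R by exact: powR_ge0.
have n0 : 0 <= #|E|%:R :> R by [].
have e2 : 2 `^ q * (\sum_x F x `^ q + \sum_x T x) <=
   2 `^ q * ((Cq + C3 * A) * B `^ (1 - q / 2) * #|E|%:R).
  rewrite ler_wpM2l//.
  have : Cq * #|E|%:R <= Cq * #|E|%:R * B `^ (1 - q / 2).
    by rewrite ler_peMr// mulr_ge0// ltW.
  lra.
apply: (le_trans e2).
have : 0 <= B `^ (1 - q / 2) * #|E|%:R by rewrite mulr_ge0// powR_ge0.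
lra.
Qed.

(** The best constant B is finite because there are finitely many sets E; it
satisfies B <= C B^(1 - q/2), and 1 - q/2 < 1. *)
Theorem restricted_maximal (q : R) : 1 < q -> q < 2 -> exists C : R, 0 < C /\
  forall (d l K : nat) (LK : l.+2 = (2 ^ K)%N) (N : nat), (N <= K)%N ->
  forall E : {set torus d l}, \sum_x Astar N (indic E) x `^ q <= C * #|E|%:R.
Proof.
move=> q1 q2; have [C [C1 HC]] := bootstrap_step q1 q2.
have g0 : 0 < q / 2 by lra.
exists (C `^ (q / 2)^-1); split; first by rewrite powR_gt0; lra.
move=> d l K LK N NK.
pose ratio (E : {set torus d l}) : R := (\sum_x Astar N (indic E) x `^ q) / #|E|%:R.
pose B := \big[Num.max/1]_(E : {set torus d l}) ratio E.
have B1 : 1 <= B by exact: bigmax_ge_id.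
have B0 : 0 < B by lra.
have [Age Ale _] := @Astar_sublinear R d l K N LK NK.
have HB (E : {set torus d l}) : \sum_x Astar N (indic E) x `^ q <= B * #|E|%:R.
  case: (posnP #|E|) => [e0|E0].
    rewrite e0 mulr0; move/eqP: e0; rewrite cards_eq0 => /eqP ->.
    rewrite big1// => x _.
    have h x' : 0 <= @indic R _ (@finset.set0 (torus d l)) x' <= 0.
      by rewrite /indic finset.in_set0 lexx.
    have -> : Astar N (@indic R _ (@finset.set0 (torus d l))) x = 0.
      by apply: le_anti; rewrite Age (Ale _ _ h).
    by rewrite powR0// gt_eqF//; lra.
  rewrite -ler_pdivrMr ?ltr0n// -/(ratio E).
  by rewrite /B (bigD1 E)//= le_max lexx.
have step := HC d l K LK N B NK B1 HB.
have BB : B <= C * B `^ (1 - q / 2).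
  have c1 : 1 <= C * B `^ (1 - q / 2) by rewrite mulr_ege1// powR_ge1//; lra.
  rewrite {1}/B; elim/big_ind : _ => // [x y hx hy|E _]; first by rewrite ge_max hx.
  rewrite /ratio; case: (posnP #|E|) => [->|E0]; last by rewrite ler_pdivrMr ?ltr0n.
  by rewrite invr0 mulr0; lra.
have Bq : B `^ (q / 2) <= C.
  rewrite -(ler_pM2r (powR_gt0 (1 - q / 2) B0)) -powR_add//.
  by rewrite addrC subrK powRr1// ltW.
move=> E; apply: (le_trans (HB E)); rewrite ler_wpM2r//.
rewrite -[leLHS](@powRK _ _ (q / 2)) ?(ltW B0) ?gt_eqF//.
by apply: ler_powR2l; [rewrite invr_ge0 ltW|exact: powR_ge0|].
Qed.

(** Interpolation applies to functions with values in [0, 1], hence the division by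
the constant c. *)
Theorem torus_maximal (p : R) : 1 < p -> exists C : R, 0 < C /\
  forall (d l K : nat) (LK : l.+2 = (2 ^ K)%N) (N : nat), (N <= K)%N ->
  forall f : torus d l -> R, (forall x, 0 <= f x) ->
  \sum_x Astar N f x `^ p <= C * \sum_x f x `^ p.
Proof.
move=> p1; pose q := Num.min ((1 + p) / 2) (3 / 2).
have q1 : 1 < q by rewrite /q lt_min; apply/andP; split; lra.
have q2 : q < 2 by rewrite /q gt_min; apply/orP; right; lra.
have qp : q < p by rewrite /q gt_min; apply/orP; left; lra.
have q0 : 0 < q by lra.
have [C1 [C10 H1]] := restricted_maximal q1 q2.
have [C2 [C20 H2]] := interpolation q0 qp.
exists (C2 * C1); split; first exact: mulr_gt0.
move=> d l K LK N NK f f0.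
have As := @Astar_sublinear R d l K N LK NK.
have [Age Ale Asub] := As.
pose c := 1 + \sum_x f x.
have c0 : 0 < c by rewrite ltr_pwDl// sumr_ge0.
pose g x := c^-1 * f x.
have g01 x : 0 <= g x <= 1.
  rewrite /g mulr_ge0 ?invr_ge0 ?(ltW c0)//= ler_pdivrMl// mulr1 /c (bigD1 x)//=.
  by rewrite addrCA lerDl addr_ge0// sumr_ge0.
have := H2 _ _ C1 As (H1 d l K LK N NK) g g01.
have gE : \sum_x g x `^ p = c^-1 `^ p * \sum_x f x `^ p.
  by rewrite mulr_sumr; apply: eq_bigr => x _; rewrite powRM// invr_ge0 ltW.
have Ag x : c^-1 * Astar N f x <= Astar N g x.
  rewrite ler_pdivrMl//.
  have h1 (i : 'I_1) : 0 <= c by exact: ltW.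
  have h2 (i : 'I_1) y : 0 <= g y by have /andP[] := g01 y.
  have h3 y : 0 <= f y <= \sum_(i < 1) c * g y.
    by rewrite big_ord1 f0 /= /g mulVKf ?lexx// (gt_eqF c0).
  by have := Asub f 1%N (fun=> c) (fun=> g) h1 h2 h3 x; rewrite big_ord1.
rewrite gE => H.
have cp : 0 < c^-1 `^ p by rewrite powR_gt0// invr_gt0.
rewrite -(ler_pM2l cp) mulrCA; apply: le_trans H.
rewrite mulr_sumr; apply: ler_sum => x _; rewrite -powRM ?invr_ge0 ?(ltW c0) ?Age//.
by apply: ler_powR2l; [lra|rewrite mulr_ge0 ?invr_ge0 ?(ltW c0)|].
Qed.

End Bootstrap.

(** * From the torus to Z^d *)

Section CountingIntegral.
Context {R : realType} {d : nat}.
Local Notation T := (Zd d).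
Local Notation mu := (@counting T R).
Local Open Scope ereal_scope.

Lemma measurable_Zd (A : set T) : measurable A.
Proof. by []. Qed.

Lemma measurable_fun_Zd d' (U : sigmaRingType d') (D : set T) (g : T -> U) :
  measurable_fun D g.
Proof. by move=> _ Y _; exact: measurable_Zd. Qed.

Lemma integral_point (g : T -> \bar R) a : \int[mu]_(x in [set a]) g x = g a.
Proof.
rewrite (eq_integral (cst (g a))); last by move=> x; rewrite inE => ->.
rewrite integral_cst//= /counting asboolT; last exact: finite_set1.
by rewrite fset_set1 cardfs1 mule1.
Qed.

Lemma sum_le_integral (g : T -> \bar R) (s : seq T) : (forall x, 0 <= g x) -> uniq s ->
  \sum_(x <- s) g x <= \int[mu]_x g x.
Proof.
move=> g0 us; rewrite (eq_bigr (fun x => \int[mu]_(y in [set x]) g y)); last first.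
  by move=> x _; rewrite integral_point.
rewrite -(@ge0_integral_bigsetU _ _ _ mu _ (fun x => [set x]) g s)//.
- by apply: ge0_subset_integral => //; exact: measurable_fun_Zd.
- by move=> i j _ _ [x [/= -> ->]].
Qed.

(** The singletons, enumerated by the countability of Z^d, exhaust the space. *)
Lemma integral_le (g : T -> \bar R) (B : \bar R) : (forall x, 0 <= g x) ->
  (forall s, uniq s -> \sum_(x <- s) g x <= B) -> \int[mu]_x g x <= B.
Proof.
move=> g0 gB; pose pick (k : nat) : option 'rV[int]_d := pickle_inv k.
pose F (k : nat) : set T := [set x | pick k = Some (x : 'rV[int]_d)].
have K k x : pick k = Some x -> choice.pickle x = k.
  by move=> h; have : oapp choice.pickle k (pick k) = k := pickle_invK k; rewrite h.
have FT : setT = \bigcup_k F k.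
  rewrite eqEsubset; split => // x _; exists (choice.pickle (x : 'rV[int]_d)) => //.
  by rewrite /F /pick /= pickleK_inv.
rewrite FT ge0_integral_bigcup//; last first.
  move=> i j _ _ [x [/= hi hj]].
  by rewrite -(K _ _ hi) -(K _ _ hj).
apply: lime_le; first by apply: is_cvg_nneseries => n _ _; exact: integral_ge0.
apply: nearW => n.
have E k : \int[mu]_(x in F k) g x = oapp g 0 (pick k).
  case e : (pick k) => [a|] /=.
    have -> : F k = [set (a : T)].
      by rewrite /F eqEsubset; split => x /=; rewrite e; [case|move=> ->].
    exact: integral_point.
  have -> : F k = set0 by rewrite /F eqEsubset; split => x //=; rewrite e.
  by rewrite integral_set0.
rewrite (eq_bigr (fun k => oapp g 0 (pick k))); last by move=> k _; exact: E.
rewrite -(big_pmap pick g); apply: gB.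
by apply: (pmap_uniq (@pickle_invK _)); exact: iota_uniq.
Qed.
End CountingIntegral.

Section Transference.
Context {R : realType}.

Definition cube_zpt (d n : nat) (i : {ffun 'I_d -> 'I_(2 * 2 ^ n).+1}) : Zd d :=
  \row_j ((i j : nat)%:Z - (2 ^ n)%:Z).

Lemma zcoord_cube_zpt d n (i : {ffun 'I_d -> 'I_(2 * 2 ^ n).+1}) j :
  zcoord (cube_zpt i) j = (i j : nat)%:Z - (2 ^ n)%:Z.
Proof. by rewrite /zcoord mxE. Qed.

Lemma zcoordB d (x y : Zd d) j : zcoord (x - y) j = zcoord x j - zcoord y j.
Proof. by rewrite /zcoord !mxE. Qed.

Lemma zcoord_inj d (x y : Zd d) : (forall j, zcoord x j = zcoord y j) -> x = y.
Proof. by move=> h; apply/rowP => j; exact: h. Qed.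

Lemma sum_Qlat (d n : nat) (V : nmodType) (phi : Zd d -> V) :
  \sum_(y \in @Qlat R d (2 ^+ n)) phi y = \sum_i phi (@cube_zpt d n i).
Proof.
rewrite (@reindex_fsbig _ _ _ _ _ (@cube_zpt d n) [set` index_enum _]).
  by rewrite -fsbig_seq// index_enum_uniq.
split.
- move=> i _ j /=; rewrite zcoord_cube_zpt in_itv/= -natrX.
  have := ltn_ord (i j); rewrite ltnS => h.
  rewrite -[- _]/((- (2 ^ n)%:R)%R) -[(2 ^ n)%:R]/((2 ^ n)%:Z%:~R : R) -rmorphN !ler_int.
  by move: (2 ^ n)%N (nat_of_ord (i j)) h => a b h; apply/andP; split; lia.
- move=> i i' _ _ h; apply/ffunP => j; apply/val_inj.
  have : zcoord (cube_zpt i) j = zcoord (cube_zpt i') j by rewrite h.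
  by rewrite !zcoord_cube_zpt => /addIr [].
- move=> y Qy.
  have yN j : (- (2 ^ n)%:Z <= zcoord y j <= (2 ^ n)%:Z)%R.
    have := Qy j; rewrite in_itv/= -natrX -[(2 ^ n)%:R]/((2 ^ n)%:Z%:~R : R) -rmorphN !ler_int.
    by [].
  have lt j : (absz (zcoord y j + (2 ^ n)%:Z)%R < (2 * 2 ^ n).+1)%N.
    by have := yN j; move: (2 ^ n)%N (zcoord y j) => a b; lia.
  exists [ffun j => Ordinal (lt j)]; first exact: mem_index_enum.
  apply: zcoord_inj => j.
  rewrite zcoord_cube_zpt ffunE /=; have := yN j.
  by move: (2 ^ n)%N (zcoord y j) => a b; lia.
Qed.

Definition cavg (d n : nat) (F : Zd d -> R) (x : Zd d) : R :=
  #|{ffun 'I_d -> 'I_(2 * 2 ^ n).+1}|%:R^-1 * \sum_i F (x - @cube_zpt d n i).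

Lemma cube_avg_le (d n : nat) (f : Zd d -> R[i]) x :
  Normc.normc (cube_avg (2 ^+ n) f x) <= cavg n (fun y => Normc.normc (f y)) x.
Proof.
rewrite /cube_avg /cavg sum_Qlat.
have -> : (#|` fset_set (@Qlat R d (2 ^+ n))| : nat) = #|{ffun 'I_d -> 'I_(2 * 2 ^ n).+1}|.
  have := @sum_Qlat d n nat (fun=> 1%N); rewrite sum1_card => <-.
  rewrite fsbig_finite/=; last exact: finite_Qlat.
  by rewrite sum1_size.
rewrite Normc.normcM ncV_nat ler_wpM2l ?invr_ge0//; exact: nc_sum.
Qed.

End Transference.

Section FiniteTransfer.
Context {R : realType}.

Definition proj (d l : nat) (y : Zd d) : torus d l := [ffun j => (zcoord y j)%:~R].

Lemma projB d l (x y : Zd d) : proj l (x - y) = proj l x - proj l y.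
Proof. by apply/ffunP => j; rewrite !ffunE zcoordB rmorphB. Qed.

Lemma proj_cube_zpt d l n (i : {ffun 'I_d -> 'I_(2 * 2 ^ n).+1}) : proj l (cube_zpt i) = cube_pt l i.
Proof. by apply/ffunP => j; rewrite !ffunE zcoord_cube_zpt rmorphB. Qed.

Lemma proj_inj d l (H : nat) (x y : Zd d) : (2 * H < l.+2)%N ->
  (forall j, (absz (zcoord x j) <= H)%N) -> (forall j, (absz (zcoord y j) <= H)%N) ->
  proj l x = proj l y -> x = y.
Proof.
move=> Hl xH yH /ffunP e; apply: zcoord_inj => j; have := e j; rewrite !ffunE.
have := xH j; have := yH j; move: (zcoord x j) (zcoord y j) => a b.
wlog ab : a b / (b <= a)%R => [W aH bH h|bH aH h].
  have /orP[ba|ab] := le_total b a; first exact: W.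
  by apply/esym; apply: W.
have : (absz (a - b)%R)%:R = 0 :> 'I_l.+2.
  have -> : (absz (a - b)%R)%:R = (a - b)%:~R :> 'I_l.+2.
    by rewrite -[in RHS](gez0_abs (_ : 0 <= a - b)) // subr_ge0.
  by rewrite rmorphB /= h subrr.
rewrite Zp_nat => /(congr1 val) /=; rewrite modn_small; first by lia.
by apply: leq_ltn_trans Hl; lia.
Qed.

(** Choose K so large that the projection to the torus is injective on all points
x - y with x in X and y in the cube of scale n x, and transport F, restricted to
these points, to the torus. *)
Lemma finite_maximal (p : R) : 1 < p -> exists C : R, 0 < C /\
  forall (d : nat) (F : Zd d -> R), (forall y, 0 <= F y) ->
  forall (X : seq (Zd d)) (n : Zd d -> nat), uniq X ->
  exists Y : seq (Zd d), uniq Y /\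
    \sum_(x <- X) cavg (n x) F x `^ p <= C * \sum_(y <- Y) F y `^ p.
Proof.
move=> p1; have p0 : 0 < p by lra.
have [C [C0 HC]] := @torus_maximal R p p1; exists C; split => //.
move=> d F F0 X n uX.
pose Y0 := [seq x - cube_zpt i | x <- X,
   i <- index_enum [the finType of {ffun 'I_d -> 'I_(2 * 2 ^ (n x)).+1}]].
pose Y := undup Y0; exists Y; split; first exact: undup_uniq.
have memY x i : x \in X -> x - @cube_zpt d (n x) i \in Y.
  move=> xX; rewrite mem_undup; apply/allpairsPdep; exists x, i; split => //.
  exact: mem_index_enum.
pose H := (\max_(y <- X ++ Y) \max_j absz (zcoord y j))%N.
have HH y j : y \in X ++ Y -> (absz (zcoord y j) <= H)%N.
  move=> yXY; apply: (@leq_trans (\max_j absz (zcoord y j))).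
    exact: (leq_bigmax (F := fun j => absz (zcoord y j))).
  by rewrite /H (big_rem y)//= leq_maxl.
pose N := (\max_(x <- X) n x).+1.
have HN x : x \in X -> (n x < N)%N.
  by move=> xX; rewrite ltnS (big_rem x)//= leq_maxl.
pose K := (2 * H + N)%N.
have [l LK] : exists l, l.+2 = (2 ^ K)%N.
  exists (2 ^ K - 2)%N; have : (K < 2 ^ K)%N by exact: ltn_expl.
  by rewrite /K /N; lia.
have Hl : (2 * H < l.+2)%N.
  by rewrite LK; apply: leq_ltn_trans (ltn_expl K (isT : (1 < 2)%N)); rewrite /K; lia.
have NK : (N <= K)%N by rewrite /K; lia.
have pinj x y : x \in X ++ Y -> y \in X ++ Y -> proj l x = proj l y -> x = y.
  by move=> hx hy; apply: (proj_inj Hl) => j; exact: HH.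
pose g (z : torus d l) : R := \sum_(y <- Y | proj l y == z) F y.
have g0 z : 0 <= g z by rewrite sumr_ge0.
have gE y : y \in Y -> g (proj l y) = F y.
  move=> yY; rewrite /g big_mkcond/= (bigD1_seq y)//= ?undup_uniq// eqxx big_seq_cond.
  rewrite big1 ?addr0// => y' /andP[y'Y y'y]; case: eqP => // e.
  by case/eqP: y'y; apply: pinj; rewrite ?mem_cat ?y'Y ?yY ?orbT.
have gY y : y \in Y -> F y <= g (proj l y) by move=> yY; rewrite gE.
have gp z : g z `^ p <= \sum_(y <- Y | proj l y == z) F y `^ p.
  have [/hasP[y yY /eqP <-]|/hasPn no] := boolP (has (fun y => proj l y == z) Y).
    rewrite gE// big_mkcond (bigD1_seq y)//= ?undup_uniq// eqxx lerDl sumr_ge0// => y' _.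
    by case: ifP => // _; exact: powR_ge0.
  rewrite /g big_seq_cond big1 ?powR0 ?gt_eqF ?sumr_ge0// => [y _|y /andP[/no/negP]//].
  exact: powR_ge0.
have step x : x \in X -> cavg (n x) F x <= Astar N g (proj l x).
  move=> xX; apply: le_trans (Astar_kM g (proj l x) (HN x xX)).
  rewrite conv_kpush /cavg ler_wpM2l ?invr_ge0//; apply: ler_sum => i _.
  by rewrite -proj_cube_zpt -projB gY// memY.
have A0 z : 0 <= Astar N g z by exact: bigmax_ge_id.
apply: (@le_trans _ _ (\sum_(x <- X) Astar N g (proj l x) `^ p)).
  rewrite big_seq [leRHS]big_seq; apply: ler_sum => x xX.
  apply: ler_powR2l; [exact: ltW| |exact: step].
  by rewrite mulr_ge0 ?invr_ge0 ?sumr_ge0.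
apply: (@le_trans _ _ (\sum_z Astar N g z `^ p)).
  rewrite -(big_map (proj l) xpredT (fun z => Astar N g z `^ p)) big_uniq/=; last first.
    rewrite map_inj_in_uniq// => x y xX yX.
    by apply: pinj; rewrite mem_cat ?xX ?yX.
  rewrite big_mkcond/=; apply: ler_sum => z _.
  by case: ifP => // _; exact: powR_ge0.
apply: (le_trans (HC d l K LK N NK g g0)); rewrite ler_wpM2l ?(ltW C0)//.
apply: (le_trans (ler_sum _ (fun z _ => gp z))).
rewrite (exchange_big_dep xpredT)//=; apply: ler_sum => y _.
by rewrite (eq_bigl (pred1 (proj l y))) ?big_pred1_eq// => z; rewrite /= eq_sym.
Qed.
End FiniteTransfer.

(** * Suprema and norms *)

Section Suprema.
Context {R : realType}.
Local Open Scope ereal_scope.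

Lemma sup_ge0 (u : nat -> R) : (forall n, 0 <= u n)%R ->
  0 <= ereal_sup [set (u n)%:E | n in [set: nat]].
Proof.
move=> u0; apply: (@le_trans _ _ (u 0%N)%:E); first by rewrite lee_fin.
by apply: ereal_sup_ubound; exists 0%N.
Qed.

(** A sum of suprema is bounded once the sum is bounded for every choice of one
index per point; this reduces the maximal function to finitely many scales. *)
Lemma sum_sup_le (T : eqType) (s : seq T) (u : T -> nat -> R) (B : R) :
  (forall x n, 0 <= u x n)%R -> uniq s ->
  (forall n : T -> nat, \sum_(x <- s) u x (n x) <= B)%R ->
  \sum_(x <- s) ereal_sup [set (u x n)%:E | n in [set: nat]] <= B%:E.
Proof.
move=> u0; elim: s B => [|x s IH] B.
  by move=> _ /(_ (fun=> 0%N)); rewrite !big_nil lee_fin.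
rewrite cons_uniq => /andP[xs us] H; rewrite big_cons.
set S := \sum_(y <- s) _.
have SB k : S <= (B - u x k)%:E.
  apply: IH => // n; pose n' y := if y == x then k else n y.
  have := H n'; rewrite big_cons {1}/n' eqxx.
  rewrite (eq_big_seq (fun y => u y (n y))) => [h|y ys]; first by lra.
  by rewrite /n'; case: eqP => // e; move: xs; rewrite -e ys.
have S0 : 0 <= S by rewrite /S sume_ge0// => y _; exact: sup_ge0.
case: S SB S0 => [r| |] SB S0.
- apply: (@le_trans _ _ ((B - r)%:E + r%:E)); last by rewrite -EFinD subrK.
  rewrite leeD2r//; apply: ge_ereal_sup => _ [k _ <-].
  by have := SB k; rewrite !lee_fin; lra.
- by have := SB 0%N; rewrite leye_eq.
- by move: S0.
Qed.

Lemma sup_poweR_le (a : nat -> R) (r : R) : (0 < r)%R -> (forall n, 0 <= a n)%R ->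
  `|ereal_sup [set (a n)%:E | n in [set: nat]]| `^ r
    <= ereal_sup [set (a n `^ r)%R%:E | n in [set: nat]].
Proof.
move=> r0 a0; have S0 := sup_ge0 a0; rewrite gee0_abs//.
have := @sup_ge0 (fun n => a n `^ r)%R (fun n => powR_ge0 _ _).
case e : (ereal_sup [set (a n `^ r)%R%:E | n in [set: nat]]) => [m| |] m0//; last by rewrite leey.
have aS n : (a n `^ r <= m)%R.
  by rewrite -lee_fin -e; apply: ereal_sup_ubound; exists n.
have m0' : (0 <= m)%R by [].
have : ereal_sup [set (a n)%:E | n in [set: nat]] <= (m `^ r^-1)%:E.
  apply: ge_ereal_sup => _ [n _ <-]; rewrite lee_fin.
  rewrite -[leLHS](@powRK _ _ r) ?gt_eqF//.
  by apply: ler_powR2l; [rewrite invr_ge0 ltW|exact: powR_ge0|].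
move=> /(@gt0_ler_poweR _ r (ltW r0)); rewrite !in_itv/= S0 leey/=.
move=> /(_ isT); rewrite lee_fin powR_ge0 leey => /(_ isT).
by rewrite powRVK// gt_eqF.
Qed.

End Suprema.

Section Conclusion.
Context {R : realType}.
Local Open Scope ereal_scope.

Lemma cavg_le (d n : nat) (F G : Zd d -> R) x : (forall y, F y <= G y)%R ->
  (cavg n F x <= cavg n G x)%R.
Proof. by move=> FG; rewrite ler_wpM2l ?invr_ge0//; apply: ler_sum => i _. Qed.

Lemma cavg_cst (d n : nat) (c : R) (x : Zd d) : cavg n (fun=> c) x = c.
Proof.
rewrite /cavg sumr_const -[(c *+ _)%R]mulr_natl mulKf// pnatr_eq0.
by rewrite card_ffun !card_ord -lt0n expn_gt0.
Qed.

(** Only the empty set is negligible for the counting measure. *)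
Lemma ess_sup_Zd_le (d : nat) (g : Zd d -> \bar R) x :
  g x <= ess_sup (@counting (Zd d) R) g.
Proof.
have [A [mA A0 AP]] := ess_sup_ge (@counting (Zd d) R) g.
rewrite leNgt; apply/negP => h.
have Ax : A x by apply: AP => /= h'; move: h; rewrite ltNge h'.
have : \int[@counting (Zd d) R]_(y in [set x]) (cst 1 y) <= 0.
  rewrite integral_cst// mul1e -A0; apply: le_measure; rewrite ?inE//.
  by move=> _ ->.
by rewrite integral_point lee_fin ler10.
Qed.

Lemma maximal_infty (d : nat) (f : Zd d -> R[i]) :
  lpnorm +oo (dyadic_max f) <= lpnorm +oo (abs_fun f).
Proof.
rewrite /lpnorm unlock; case: ifPn => // mu0.
set M := ess_sup _ (abse \o abs_fun f).
have FM x : (Normc.normc (f x))%:E <= M.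
  have := ess_sup_Zd_le (abse \o abs_fun f) x; rewrite /= /abs_fun.
  by rewrite ger0_norm ?nc_ge0.
apply/ess_supP/nearW => x /=.
have a0 n : (0 <= Normc.normc (cube_avg (2 ^+ n) f x))%R by exact: nc_ge0.
rewrite gee0_abs; last exact: sup_ge0.
apply: ge_ereal_sup => _ [n _ <-].
case: M FM => [m| |] FM; last 2 first.
- by rewrite leey.
- by have := FM x; rewrite leeNy_eq.
rewrite lee_fin; apply: (le_trans (cube_avg_le n f x)).
by rewrite -[leRHS](cavg_cst n m x); apply: cavg_le => y; have := FM y; rewrite lee_fin.
Qed.

Lemma maximal_finite (p : R) : (1 < p)%R -> exists C : R, (0 < C)%R /\
  forall (d : nat) (f : Zd d -> R[i]),
  lpnorm p%:E (dyadic_max f) <= C%:E * lpnorm p%:E (abs_fun f).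
Proof.
move=> p1; have p0 : (0 < p)%R by lra.
have [C [C0 HC]] := @finite_maximal R p p1.
exists (C `^ p^-1)%R; split; first by rewrite powR_gt0.
move=> d f; rewrite /lpnorm unlock.
set I := \int[_]_x `|abs_fun f x| `^ p.
have I0 : 0 <= I by apply: integral_ge0 => x _; exact: poweR_ge0.
suff H : \int[counting]_x `|dyadic_max f x| `^ p <= C%:E * I.
  rewrite -poweR_EFin -poweRM ?lee_fin ?(ltW C0)//.
  apply: gt0_ler_poweR H; rewrite ?invr_ge0 ?(ltW p0)// in_itv/= leey andbT.
    by apply: integral_ge0 => x _; exact: poweR_ge0.
  by rewrite mule_ge0// lee_fin ltW.
apply: integral_le => [x|s us]; first exact: poweR_ge0.
pose u (x : Zd d) n := (Normc.normc (cube_avg (2 ^+ n) f x) `^ p)%R.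
apply: (@le_trans _ _ (\sum_(x <- s) ereal_sup [set (u x n)%:E | n in [set: nat]])).
  by apply: lee_sum => x _; apply: sup_poweR_le => // n; exact: nc_ge0.
case e : I I0 => [r| |] I0 //; last by rewrite gt0_muley ?lte_fin// leey.
rewrite -EFinM; apply: sum_sup_le => //; first by move=> x n; exact: powR_ge0.
move=> n; pose F y := Normc.normc (f y).
have F0 y : (0 <= F y)%R by exact: nc_ge0.
have [Y [uY HY]] := HC d F F0 s n us.
apply: (@le_trans _ _ (\sum_(x <- s) cavg (n x) F x `^ p)%R).
  apply: ler_sum => x _; apply: ler_powR2l; [exact: ltW|exact: nc_ge0|exact: cube_avg_le].
apply: (le_trans HY); rewrite ler_wpM2l ?(ltW C0)//.
rewrite -lee_fin -e -sumEFin.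
apply: le_trans (sum_le_integral _ uY); last by move=> x; exact: poweR_ge0.
apply: lee_sum => y _.
by have -> : `|abs_fun f y| = (F y)%:E by rewrite gee0_abs// lee_fin nc_ge0.
Qed.

End Conclusion.

Theorem theorem4 (R : realType) (p : \bar R) (hp : (1 < p)%E) :
  exists C : R, 0 < C /\
    forall (d : nat) (hd : (0 < d)%N) (f : Zd d -> R[i]),
      in_lp p f ->
      (lpnorm p (dyadic_max f) <= C%:E * lpnorm p (abs_fun f))%E.
Proof.
case: p hp => [p|_|//]; last first.
  by exists 1; split => // d _ f _; rewrite mul1e; exact: maximal_infty.
rewrite lte_fin => /maximal_finite[C [C0 HC]].
by exists C; split => // d _ f _; exact: HC.
Qed.
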